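(* For any $\lambda>0$ there exists $m>0$ such that, for any function $f:\{0,1\}^{\mathbb Z}\to\mathbb R$ depending on the state of finitely many vertices, there exists a constant $C_f>0$ with $$\sup_{\eta\in\{0,1\}^{\mathbb Z}}\big|\hat{\mathbb E}_\eta\big(f(\eta(t))\big)-\hat\pi(f)\big|\le C_fe^{-mt}\qquad\text{for all }t\ge0,$$ where $\hat{\mathbb E}_\eta$ is the expectation for the Double Flip Process on $\mathbb Z$ with initial state $\eta$.
   Context: The Double Flip Process (DFP) with parameter $\lambda>0$ is the interacting particle system on $\{0,1\}^{\mathbb Z}$ in which, independently for each edge $\{x,x+1\}$ of $\mathbb Z$, the pair $(\eta_x,\eta_{x+1})$ is updated as: $(0,0)\to(1,1)$ at rate $(\sqrt{1+\lambda}+1)^2/2$; $(1,1)\to(0,0)$ at rate $(\sqrt{1+\lambda}-1)^2/2$; $(1,0)\to(0,1)$ and $(0,1)\to(1,0)$ each at rate $\lambda/2$. $\hat\pi$ is the product Bernoulli measure with $\hat\pi(\eta_x=1)=\hat p=\frac{\sqrt{1+\lambda}+1}{2\sqrt{1+\lambda}}$; it is reversible for the DFP. *)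

(* Defs.v *)
From HB Require Import structures.
From mathcomp Require Import all_boot all_order all_algebra.
From mathcomp Require Import all_classical all_reals all_analysis.

Set Implicit Arguments.
Unset Strict Implicit.
Unset Printing Implicit Defensive.

Import Order.TTheory GRing.Theory Num.Theory.
Import numFieldNormedType.Exports.

Local Open Scope classical_set_scope.
Local Open Scope ring_scope.

Definition config : Type := prod_topology (fun _ : int => bool).
HB.instance Definition _ := Topological.copy config (prod_topology (fun _ : int => bool)).
HB.instance Definition _ := Pointed.copy config (prod_topology (fun _ : int => bool)).

Definition occupied_events : set (set config) :=
  [set A | exists x : int, A = [set eta : config | eta x]].

(* The product sigma-algebra on [config]. *)
Notation config_meas := (g_sigma_algebraType occupied_events).

Definition local_fun (R : Type) (f : config -> R) : Prop :=
  exists D : seq int, forall eta zeta : config,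
    {in D, forall x, eta x = zeta x} -> f eta = f zeta.

Definition double_flip (eta : config) (x : int) : config :=
  fun y => if (y == x) || (y == x + 1) then ~~ eta y else eta y.

Section DoubleFlipProcess.
Context {R : realType}.
Implicit Types (lambda p t : R) (eta zeta : config).

(* Every transition of the pair (eta_x, eta_(x+1)), including the exchanges
   (1,0) <-> (0,1), negates both entries; only the rate depends on the pair. *)
Definition edge_rate lambda (a b : bool) : R :=
  match a, b with
  | false, false => (Num.sqrt (1 + lambda) + 1) ^+ 2 / 2
  | true, true => (Num.sqrt (1 + lambda) - 1) ^+ 2 / 2
  | _, _ => lambda / 2
  end.

(* The sum over [int] is a finitely supported sum; this is only meaningful for
   local [f], for which all but finitely many terms vanish. *)
Definition dfp_generator lambda (f : config -> R) eta : R :=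
  \sum_(x \in [set: int])
    edge_rate lambda (eta x) (eta (x + 1)) * (f (double_flip eta x) - f eta).

Definition expect_from d (Omega : measurableType d)
    (P : config -> probability Omega R) (X : R -> Omega -> config)
    eta t (f : config -> R) : R :=
  (\int[P eta]_w f (X t w))%R.

Definition history d (Omega : measurableType d) (X : R -> Omega -> config)
    (s : R) : set (set Omega) :=
  <<s [set B | exists u : R, 0 <= u <= s /\
         exists2 A : set config_meas, measurable A & B = X u @^-1` A] >>.

(* [X] under the laws [P eta] realises the interacting particle system with the
   above rates: a Feller Markov process with cadlag paths whose generator
   agrees with [dfp_generator] on local functions. Since the rates are bounded
   and of finite range, local functions form a core (Liggett, Interacting
   Particle Systems, Thm I.3.9), so this determines the law under each [P eta].
   Only times [t >= 0] are relevant. *)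
Record is_dfp lambda d (Omega : measurableType d)
    (P : config -> probability Omega R) (X : R -> Omega -> config) : Prop := {
  dfp_measurable : forall t, 0 <= t ->
    measurable_fun [set: Omega] (X t : Omega -> config_meas) ;
  dfp_start : forall eta, P eta (X 0 @^-1` [set eta]) = 1%E ;
  dfp_right_continuous : forall w t, 0 <= t ->
    X u w @[u --> t^'+] --> X t w ;
  dfp_left_limits : forall w t, 0 < t ->
    cvg (X u w @[u --> t^'-]) ;
  dfp_markov : forall eta s t, 0 <= s -> 0 <= t ->
    forall B : set Omega, history X s B ->
    forall A : set config_meas, measurable A ->
    P eta (B `&` X (s + t) @^-1` A) =
      (\int[P eta]_(w in B) P (X s w) (X t @^-1` A))%E ;
  dfp_feller : forall t, 0 <= t -> forall f : config -> R, continuous f ->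
    continuous (fun eta => expect_from P X eta t f) ;
  dfp_generatorP : forall f : config -> R, local_fun f ->
    forall e : R, 0 < e -> \forall t \near 0^'+, forall eta,
      `| (expect_from P X eta t f - f eta) / t - dfp_generator lambda f eta |
        <= e
}.

Definition is_bernoulli_product p (mu : probability config_meas R) : Prop :=
  forall (D : seq int) (zeta : config), uniq D ->
    mu [set eta : config | {in D, forall x, eta x = zeta x}] =
      (\prod_(x <- D) (if zeta x then p else 1 - p))%:E.

Definition p_hat lambda : R :=
  (Num.sqrt (1 + lambda) + 1) / (2 * Num.sqrt (1 + lambda)).

End DoubleFlipProcess.

(* Main.v *)
(** Write [s = sqrt (1 + lambda)] and let [xi] be a spin configuration on the
    edges of [Z] with [eta_x = (xi_(x-1) == xi_x)].  A double flip of [eta] is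
    then a single flip of [xi], and the process becomes the Glauber dynamics of
    the ferromagnetic one-dimensional Ising model in which the spin [t] with
    neighbours [a] and [b] flips at rate [(s - a t) (s - t b) / 2].  This
    dynamics is attractive and reversible.

    Attractiveness bounds the oscillation of any local function by the mean of
    a sum of spins started from the all-plus state.  The density of that law
    with respect to the Gibbs weight stays increasing, and against an
    increasing density the dynamics pulls a spin towards its conditional mean
    at least as fast as the heat-bath dynamics slowed down to its smallest
    rate.  The heat-bath dynamics acts linearly on spins, with contraction
    factor [2 s / (s ^ 2 + 1) < 1], so the decay is exponential with a rate
    that does not depend on the volume.

    The infinite process is compared with powers of [1 + h L], for [L] the
    generator in a finite box: the Markov property telescopes the error into a
    part that vanishes with [h] and a boundary part that finite speed of
    propagation makes exponentially small in the size of the box. *)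

Require Import Defs.
From mathcomp Require Import all_boot all_order all_algebra.
From mathcomp Require Import all_classical all_reals all_analysis.
From mathcomp Require Import measurable_realfun ring lra zify.
Import Order.TTheory GRing.Theory Num.Theory.
Import numFieldNormedType.Exports.
Local Open Scope classical_set_scope.
Local Open Scope ring_scope.

(** * Glauber dynamics of the Ising chain in a finite box *)

Section Box.
Set Implicit Arguments.
Unset Strict Implicit.
Context {R : realFieldType} (s : R) (N : nat).
Hypothesis s_gt1 : 1 < s.

Definition spins := {ffun 'I_N -> bool}.
Implicit Types (h e a : R) (k : nat) (xi zeta : spins) (g f : spins -> R) (i j : 'I_N).

Definition sgb (b : bool) : R := if b then 1 else -1.

(** Site [i] of the box has position [i.+1]; the value [0] at the positions
    outside [1 .. N] gives free boundary conditions in [glauber_rate] and [gibbs]. *)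
Definition spin xi (k : nat) : R :=
  if k is k'.+1 then oapp (fun i => sgb (xi i)) 0 (insub k') else 0.

Arguments spin : simpl never.

Definition flip xi i : spins := [ffun j => if j == i then ~~ xi j else xi j].
Definition set_spin xi i b : spins := [ffun j => if j == i then b else xi j].
Definition flip_all xi : spins := [ffun j => ~~ xi j].

Definition glauber_rate xi i : R :=
  (s - spin xi i * spin xi i.+1) * (s - spin xi i.+1 * spin xi i.+2) / 2.

Definition euler h g xi : R :=
  g xi + h * \sum_i glauber_rate xi i * (g (flip xi i) - g xi).

(** Up to a constant, the Ising weight at the inverse temperature [beta] with [tanh beta = 1 / s]: a
    factor is [s + 1] for agreeing neighbours and [s - 1] for opposite ones. The first and the last
    factor are [s]. *)
Definition gibbs xi : R := \prod_(k < N.+1) (s + spin xi k * spin xi k.+1).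

Definition spins_le xi zeta := forall i, xi i ==> zeta i.
Definition increasing g := forall xi zeta, spins_le xi zeta -> g xi <= g zeta.

Lemma sgbN b : sgb (~~ b) = - sgb b.
Proof. by case: b; rewrite /sgb /= ?opprK. Qed.

Lemma sgb_bound b : -1 <= sgb b <= 1.
Proof. by case: b; rewrite /sgb; apply/andP; split; lra. Qed.

Lemma spin_ord xi i : spin xi i.+1 = sgb (xi i).
Proof. by rewrite /spin valK. Qed.

Lemma spin_out xi k : (N <= k)%N -> spin xi k.+1 = 0.
Proof. by move=> Nk; rewrite /spin insubF // ltnNge Nk. Qed.

Lemma spinP xi k : (k = 0%N \/ (N < k)%N) /\ spin xi k = 0 \/
  exists2 i : 'I_N, k = i.+1 & spin xi k = sgb (xi i).
Proof.
case: k => [|k]; first by left; split; [left|].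
case: (ltnP k N) => kN; last by left; split; [right; lia|rewrite spin_out].
by right; exists (Ordinal kN) => //; rewrite -spin_ord.
Qed.

Lemma spin_bound xi k : -1 <= spin xi k <= 1.
Proof.
case: (spinP xi k) => [[_ ->]|[i _ ->]]; last exact: sgb_bound.
by apply/andP; split; lra.
Qed.

Lemma flipK i : involutive (flip ^~ i).
Proof.
by move=> xi; apply/ffunP => j; rewrite !ffunE; case: eqP => // ->; rewrite negbK.
Qed.

Lemma flip_allK : involutive flip_all.
Proof. by move=> xi; apply/ffunP => j; rewrite !ffunE negbK. Qed.

Lemma flip_comm xi i j : flip (flip xi i) j = flip (flip xi j) i.
Proof.
apply/ffunP => k; rewrite !ffunE.
by case: (eqVneq k i); case: (eqVneq k j).
Qed.

Lemma flip_flip_all xi i : flip (flip_all xi) i = flip_all (flip xi i).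
Proof. by apply/ffunP => k; rewrite !ffunE; case: (eqVneq k i). Qed.

Lemma spin_flip_all xi k : spin (flip_all xi) k = - spin xi k.
Proof.
case: k => [|k]; first by rewrite /spin /= oppr0.
rewrite /spin; case: insubP => [i _ _|_] /=; last by rewrite oppr0.
by rewrite ffunE sgbN.
Qed.

Lemma spin_flip_same xi i : spin (flip xi i) i.+1 = - spin xi i.+1.
Proof. by rewrite !spin_ord ffunE eqxx sgbN. Qed.

Lemma spin_flip_other xi i k : k != i.+1 -> spin (flip xi i) k = spin xi k.
Proof.
case: k => [|k] // ki; rewrite /spin; case: insubP => //= j _ jk.
by rewrite ffunE; case: eqP => // ji; rewrite -jk ji eqxx in ki.
Qed.

Lemma spin_le_spins xi zeta k : spins_le xi zeta -> spin xi k <= spin zeta k.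
Proof.
move=> le; case: k => [|k] //; rewrite /spin; case: insubP => //= i _ _.
by have := le i; case: (xi i); case: (zeta i) => // _; rewrite /sgb /=; lra.
Qed.

Lemma spin_prod_bound xi k l : -1 <= spin xi k * spin xi l <= 1.
Proof.
by rewrite -ler_norml normrM mulr_ile1 // ler_norml spin_bound.
Qed.

Lemma glauber_rate_ge0 xi i : 0 <= glauber_rate xi i.
Proof.
rewrite /glauber_rate; have /andP[_ a] := spin_prod_bound xi i i.+1.
have /andP[_ b] := spin_prod_bound xi i.+1 i.+2.
by have s1 := s_gt1; rewrite divr_ge0 // mulr_ge0 //; lra.
Qed.

Definition rate_max : R := (s + 1) ^+ 2 / 2.

Lemma rate_max_ge0 : 0 <= rate_max.
Proof. by rewrite /rate_max divr_ge0 // sqr_ge0. Qed.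

Lemma glauber_rate_max xi i : glauber_rate xi i <= rate_max.
Proof.
rewrite /glauber_rate /rate_max; have /andP[a a'] := spin_prod_bound xi i i.+1.
have /andP[b b'] := spin_prod_bound xi i.+1 i.+2.
by have s1 := s_gt1; rewrite ler_pM2r ?invr_gt0 // expr2 ler_pM //; lra.
Qed.

Lemma glauber_rate_far xi i j :
  j != i -> j != i.+1 :> nat -> j.+1 != i :> nat ->
  glauber_rate (flip xi i) j = glauber_rate xi j.
Proof.
move=> ji ji1 j1i; by rewrite /glauber_rate !spin_flip_other.
Qed.

Lemma glauber_rate_flip_all xi i : glauber_rate (flip_all xi) i = glauber_rate xi i.
Proof. by rewrite /glauber_rate !spin_flip_all !mulrNN. Qed.

Lemma gibbs_gt0 xi : 0 < gibbs xi.
Proof.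
apply: prodr_gt0 => k _; have /andP[a _] := spin_prod_bound xi k k.+1.
by move: s_gt1; lra.
Qed.

Lemma gibbs_flip_all xi : gibbs (flip_all xi) = gibbs xi.
Proof. by apply: eq_bigr => k _; rewrite !spin_flip_all mulrNN. Qed.

Lemma gibbs_split xi i :
  gibbs xi = (s + spin xi i * spin xi i.+1) * (s + spin xi i.+1 * spin xi i.+2) *
    \prod_(k < N.+1 | (k != i :> nat) && (k != i.+1 :> nat))
      (s + spin xi k * spin xi k.+1).
Proof.
have ltiN : (i < N.+1)%N by rewrite ltnS ltnW.
have ltiN' : (i.+1 < N.+1)%N by rewrite ltnS.
rewrite /gibbs (bigD1 (Ordinal ltiN)) //=.
have ne : Ordinal ltiN' != Ordinal ltiN.
  by apply/eqP => /(congr1 val) /=; lia.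
by rewrite (bigD1 (Ordinal ltiN') ne) /= mulrA.
Qed.

(** For each neighbour [a] of the spin [t] at [i], the weight contributes [s + a t] and the rate
    [s - a t]. The flip exchanges the two, and the other factors of [gibbs] avoid site [i]. *)
Lemma detailed_balance xi i :
  gibbs xi * glauber_rate xi i = gibbs (flip xi i) * glauber_rate (flip xi i) i.
Proof.
rewrite /glauber_rate !(gibbs_split _ i) spin_flip_same.
rewrite (@spin_flip_other xi i i) ?(@spin_flip_other xi i i.+2); try lia.
rewrite [X in _ = _ * X * _](_ : _ =
  \prod_(k < N.+1 | (k != i :> nat) && (k != i.+1 :> nat))
    (s + spin xi k * spin xi k.+1)); first by ring.
by apply: eq_bigr => k /andP[k1 k2]; rewrite !spin_flip_other //; lia.
Qed.

(** * Algebra of Euler steps *)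

Lemma eulerD h g f xi : euler h (fun x => g x + f x) xi = euler h g xi + euler h f xi.
Proof.
rewrite /euler addrACA -mulrDr -big_split /=. congr (_ + _ * _).
by apply: eq_bigr => i _; ring.
Qed.

Lemma eulerZ h a g xi : euler h (fun x => a * g x) xi = a * euler h g xi.
Proof.
rewrite /euler [RHS]mulrDr [in RHS]mulrCA [X in _ = _ + _ * X]mulr_sumr; congr (_ + _ * _).
by apply: eq_bigr => i _; ring.
Qed.

Lemma euler_cst h a : euler h (fun=> a) = fun=> a.
Proof.
apply: funext => xi; rewrite /euler big1 ?mulr0 ?addr0 // => i _.
by rewrite subrr mulr0.
Qed.

Lemma euler_flip_all h g : euler h (g \o flip_all) = euler h g \o flip_all.
Proof.
apply: funext => xi; rewrite /euler /=; congr (_ + _ * _).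
by apply: eq_bigr => i _; rewrite glauber_rate_flip_all flip_flip_all.
Qed.

Lemma iter_eulerD h k g f xi :
  iter k (euler h) (fun x => g x + f x) xi = iter k (euler h) g xi + iter k (euler h) f xi.
Proof.
elim: k xi => //= k IH xi; rewrite -eulerD.
by congr (euler h _ xi); apply: funext.
Qed.

Lemma iter_eulerZ h k a g xi :
  iter k (euler h) (fun x => a * g x) xi = a * iter k (euler h) g xi.
Proof.
elim: k xi => //= k IH xi; rewrite -eulerZ.
by congr (euler h _ xi); apply: funext.
Qed.

Lemma iter_euler_cst h k a : iter k (euler h) (fun=> a) = fun=> a.
Proof. by elim: k => //= k ->; rewrite euler_cst. Qed.

Lemma iter_euler_sum h k (I : finType) (P : pred I) (G : I -> spins -> R) xi :
  iter k (euler h) (fun x => \sum_(i | P i) G i x) xi =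
  \sum_(i | P i) iter k (euler h) (G i) xi.
Proof.
elim: (index_enum I) => [|i r IH].
  rewrite big_nil (_ : (fun=> _) = fun=> 0) ?iter_euler_cst //.
  by apply: funext => x; rewrite big_nil.
rewrite big_cons -IH; case: ifPn => Pi; last first.
  by congr (iter k _ _ _); apply: funext => x; rewrite big_cons (negPf Pi).
rewrite -iter_eulerD; congr (iter k _ _ _).
by apply: funext => x; rewrite big_cons Pi.
Qed.

Lemma iter_euler_flip_all h k g :
  iter k (euler h) (g \o flip_all) = iter k (euler h) g \o flip_all.
Proof. by elim: k => //= k ->; rewrite euler_flip_all. Qed.

(** * Attractiveness *)

Lemma set_spin_le xi zeta i b :
  spins_le xi zeta -> spins_le (set_spin xi i b) (set_spin zeta i b).
Proof. by move=> le j; rewrite !ffunE; case: eqP => // _; exact: implybb. Qed.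

(** The update leaves the spin at [i] up with probability [q]. The interaction is ferromagnetic, so
    [q] increases with the neighbours. A flip has probability at most [1 / 2], so [q] is at least
    [1 / 2] from an up spin and at most [1 / 2] from a down spin. *)
Lemma site_update_increasing e g i xi zeta :
  0 <= e -> e * rate_max <= 1 / 2 -> increasing g -> spins_le xi zeta ->
  g xi + e * (glauber_rate xi i * (g (flip xi i) - g xi)) <=
  g zeta + e * (glauber_rate zeta i * (g (flip zeta i) - g zeta)).
Proof.
move=> e0 eC incg le.
pose q (x : spins) := if x i then 1 - e * glauber_rate x i else e * glauber_rate x i.
have qE (x : spins) : g x + e * (glauber_rate x i * (g (flip x i) - g x)) =
    q x * g (set_spin x i true) + (1 - q x) * g (set_spin x i false).
  have xE : x = set_spin x i (x i).
    by apply/ffunP => j; rewrite ffunE; case: eqP => // ->.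
  have fE : flip x i = set_spin x i (~~ x i).
    by apply/ffunP => j; rewrite !ffunE; case: eqP => // ->.
  have gE : g x = g (set_spin x i (x i)) by rewrite -xE.
  by rewrite /q fE gE; case: (x i) => /=; ring.
have cb (x : spins) : 0 <= e * glauber_rate x i <= 1 / 2.
  rewrite mulr_ge0 ?glauber_rate_ge0 //=; apply: le_trans eC.
  by rewrite ler_wpM2l // glauber_rate_max.
have q01 (x : spins) : 0 <= q x <= 1.
  by have /andP[a b] := cb x; rewrite /q; case: (x i); apply/andP; split; lra.
have ql : q xi <= q zeta.
  have /andP[a b] := cb xi; have /andP[a' b'] := cb zeta.
  have s1 := s_gt1.
  have lea := spin_le_spins i le; have leb := spin_le_spins i.+2 le.
  have /andP[a1 a2] := spin_bound xi i; have /andP[a3 a4] := spin_bound zeta i.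
  have /andP[b1 b2] := spin_bound xi i.+2; have /andP[b3 b4] := spin_bound zeta i.+2.
  move: (le i); rewrite /q; case xE: (xi i); case zE: (zeta i) => // _; last 1 first.
  - rewrite ler_wpM2l // /glauber_rate !spin_ord xE zE /sgb mulrN1 mulN1r mulrN1 mulN1r.
    by rewrite !opprK ler_pM2r ?invr_gt0 //; apply: ler_pM; lra.
  - rewrite lerD2l lerN2 ler_wpM2l // /glauber_rate !spin_ord xE zE /sgb !mulr1 !mul1r.
    by rewrite ler_pM2r ?invr_gt0 //; apply: ler_pM; lra.
  - by lra.
rewrite !qE.
have u : g (set_spin xi i true) <= g (set_spin zeta i true).
  exact/incg/set_spin_le.
have v : g (set_spin xi i false) <= g (set_spin zeta i false).
  exact/incg/set_spin_le.
have w : g (set_spin zeta i false) <= g (set_spin zeta i true).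
  by apply: incg => j; rewrite !ffunE; case: eqP => // _; exact: implybb.
have /andP[q0 q1] := q01 xi.
apply: (@le_trans _ _ (q xi * g (set_spin zeta i true) +
  (1 - q xi) * g (set_spin zeta i false))).
  by apply: lerD; rewrite ler_wpM2l // subr_ge0.
rewrite -subr_ge0 [X in 0 <= X](_ : _ = (q zeta - q xi) *
  (g (set_spin zeta i true) - g (set_spin zeta i false))); last by ring.
by rewrite mulr_ge0 // subr_ge0.
Qed.

(** As [rate_max] is [(s + 1) ^ 2 / 2], this says [h * N * rate_max <= 1 / 2]: [h * N] is then
    admissible as the [e] of [site_update_increasing]. *)
Definition small_step h := 0 <= h /\ h * N%:R * (s + 1) ^+ 2 <= 1.

(** An Euler step is the average over all sites of single-site updates with step [h * N], each of
    which is monotone. *)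
Lemma euler_increasing h g : small_step h -> increasing g -> increasing (euler h g).
Proof.
move=> [h0 hN] incg xi zeta le.
have [N0|N0] := posnP N.
  rewrite /euler !big1 ?mulr0 ?addr0 ?incg //; move=> i; have := ltn_ord i; lia.
have NR : 0 < N%:R :> R by rewrite ltr0n.
have E (x : spins) : euler h g x = N%:R^-1 * \sum_(i < N)
   (g x + (h * N%:R) * (glauber_rate x i * (g (flip x i) - g x))).
  apply: (mulfI (lt0r_neq0 NR)); rewrite mulrA mulfV ?lt0r_neq0 // mul1r.
  by rewrite big_split /= sumr_const card_ord -mulr_sumr -mulr_natl /euler; ring.
rewrite !E ler_wpM2l ?invr_ge0 ?ler0n //; apply: ler_sum => i _.
apply: site_update_increasing => //; first by rewrite mulr_ge0 ?ler0n.
by rewrite /rate_max; lra.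
Qed.

Lemma iter_euler_increasing h k g :
  small_step h -> increasing g -> increasing (iter k (euler h) g).
Proof. by move=> hs incg; elim: k => //= k; exact: euler_increasing. Qed.

(** * Reversibility and exponential decay of spins *)

Definition dot g f : R := \sum_xi gibbs xi * g xi * f xi.

(** The substitution of [flip xi i] for [xi], with detailed balance, moves the flip from one
    argument of [dot] to the other. *)
Lemma euler_sym h g f : dot g (euler h f) = dot (euler h g) f.
Proof.
have E g' f' : dot g' (euler h f') = dot g' f' +
    h * \sum_i \sum_xi gibbs xi * glauber_rate xi i * g' xi * (f' (flip xi i) - f' xi).
  rewrite /dot /euler exchange_big /= mulr_sumr -big_split /=.
  apply: eq_bigr => xi _; rewrite mulrDr; congr (_ + _).
  by rewrite !mulr_sumr; apply: eq_bigr => i _; ring.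
have C g' f' : dot g' f' = dot f' g' by apply: eq_bigr => xi _; ring.
rewrite E [RHS]C E [dot g f]C; congr (_ + _ * _); apply: eq_bigr => i _.
under eq_bigr do rewrite mulrBr.
under [RHS]eq_bigr do rewrite mulrBr.
rewrite !sumrB; congr (_ - _); last by apply: eq_bigr => xi _; ring.
rewrite (reindex_inj (inv_inj (flipK i))) /=; apply: eq_bigr => xi _.
by rewrite flipK -detailed_balance; ring.
Qed.

Lemma iter_euler_sym h k g f : dot g (iter k (euler h) f) = dot (iter k (euler h) g) f.
Proof.
elim: k f => [|k IH] f //; rewrite iterSr IH euler_sym.
by rewrite -iterS.
Qed.

(** With [tanh beta = 1 / s] this is [tanh (2 beta)]: given its neighbours [a] and [b], an interior
    spin has conditional mean [gam * (a + b) / 2]. *)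
Definition gam : R := 2 * s / (s ^+ 2 + 1).
Definition decay_rate : R := (s ^+ 2 - 1) * (1 - gam).

Lemma gam_lt1 : gam < 1.
Proof.
have s1 := s_gt1; have p : 0 < s ^+ 2 + 1 by rewrite ltr_wpDl ?sqr_ge0.
by rewrite /gam ltr_pdivrMr // mul1r -subr_gt0 (_ : _ - _ = (s - 1) ^+ 2);
  [rewrite exprn_gt0 // subr_gt0|ring].
Qed.

(** An end spin, with its single neighbour, has heat-bath coefficient [s^-1]; so [gam] also serves
    as contraction factor at the ends. *)
Lemma gam_ge : s^-1 <= gam.
Proof.
have s1 := s_gt1; have p : 0 < s ^+ 2 + 1 by rewrite ltr_wpDl ?sqr_ge0.
have s0 : 0 < s by lra.
rewrite /gam ler_pdivlMr // mulrDr mulr1 expr2 mulrA mulVf ?mul1r ?lt0r_neq0 //.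
have : s^-1 <= 1 by rewrite invf_le1 // ltW.
by lra.
Qed.

Lemma decay_rate_gt0 : 0 < decay_rate.
Proof.
have s1 := s_gt1; have g1 := gam_lt1.
by rewrite /decay_rate mulr_gt0 ?subr_gt0 // expr2; nra.
Qed.

(** The first summand is the heat-bath drift at the smallest rate [s ^ 2 - 1];
    the excess rate [kap] does not see the spin at [i], so by reversibility it
    only helps against an increasing density. *)
Lemma rate_split i : exists ql qr : R, [/\ 0 <= ql, 0 <= qr, ql + qr <= gam &
  exists kap : spins -> R, [/\ forall xi, 0 <= kap xi,
    forall xi, kap (flip xi i) = kap xi &
    forall xi, 2 * (spin xi i.+1 * glauber_rate xi i) =
      (s ^+ 2 - 1) * (spin xi i.+1 - ql * spin xi i - qr * spin xi i.+2) +
      kap xi * (spin xi i.+1 * glauber_rate xi i)]].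
Proof.
have s1 := s_gt1; have s0 : 0 < s by lra.
have p : 0 < s ^+ 2 + 1 by rewrite ltr_wpDl ?sqr_ge0.
have sgb2 b : sgb b * sgb b = 1 by case: b; rewrite /sgb /= ?mulrNN mulr1.
have i0 : 0 <= s^-1 by rewrite invr_ge0 ltW.
have k0 : 0 <= 2 / s ^+ 2 by rewrite divr_ge0 // sqr_ge0.
(* An end spin with neighbour [b] has conditional mean [b / s], and the rates of its two flips add
   up to [s ^ 2]. The excess over [s ^ 2 - 1] is [1], whence the coefficient [2 / s ^ 2]. *)
have edge (xi : spins) (b : R) : 2 * (spin xi i.+1 * (s * (s - spin xi i.+1 * b) / 2)) =
    (s ^+ 2 - 1) * (spin xi i.+1 - s^-1 * b) +
    2 / s ^+ 2 * (spin xi i.+1 * (s * (s - spin xi i.+1 * b) / 2)).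
  have t2 : spin xi i.+1 * spin xi i.+1 = 1 by rewrite spin_ord.
  have -> : spin xi i.+1 * (s * (s - spin xi i.+1 * b) / 2) =
    s * (s * spin xi i.+1 - (spin xi i.+1 * spin xi i.+1) * b) / 2 by field.
  by rewrite t2; field; rewrite lt0r_neq0.
have [il|il] := posnP i.
  exists 0, s^-1; split; rewrite ?add0r ?gam_ge //.
  exists (fun=> 2 / s ^+ 2); split=> // xi.
  have := edge xi (spin xi i.+2).
  by rewrite /glauber_rate (_ : spin xi i = 0) ?il // mul0r mulr0 !subr0.
have [ir|ir] := eqVneq i.+1 N.
  exists s^-1, 0; split; rewrite ?addr0 ?gam_ge //.
  exists (fun=> 2 / s ^+ 2); split=> // xi.
  have := edge xi (spin xi i).
  have o : spin xi i.+2 = 0 by rewrite spin_out // ir.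
  rewrite /glauber_rate o.
  by rewrite !mulr0 !subr0 (mulrC (spin xi i)) [_ * s]mulrC.
have gh : 0 <= gam / 2 by rewrite divr_ge0 // (le_trans i0 gam_ge).
exists (gam / 2), (gam / 2); split=> //; first by lra.
(* The two flip rates add up to [s ^ 2 + 1] when the neighbours agree and to [s ^ 2 - 1] when they
   differ, so the excess vanishes in the latter case. *)
exists (fun xi => 2 * (1 + spin xi i * spin xi i.+2) / (s ^+ 2 + 1)); split=> xi.
- have /andP[a _] := spin_prod_bound xi i i.+2.
  by rewrite divr_ge0 ?mulr_ge0 //; lra.
- by rewrite !spin_flip_other //; lia.
rewrite /glauber_rate.
have [[[e|e] _]|[l _ ->]] := spinP xi i.
- by exfalso; lia.
- by exfalso; have := ltn_ord i; lia.
have [[[e|e] _]|[r _ ->]] := spinP xi i.+2.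
- by [].
- by exfalso; have := ltn_ord i; lia.
rewrite spin_ord /gam.
by case: (xi l); case: (xi i); case: (xi r); rewrite /sgb /=; field; rewrite lt0r_neq0.
Qed.

Lemma dot_euler_spin h g i : 0 <= h -> increasing g -> exists ql qr : R,
  [/\ 0 <= ql, 0 <= qr, ql + qr <= gam &
  dot g (euler h (spin ^~ i.+1)) <= dot g (spin ^~ i.+1) -
    h * (s ^+ 2 - 1) * (dot g (spin ^~ i.+1) - ql * dot g (spin ^~ i) -
                        qr * dot g (spin ^~ i.+2))].
Proof.
move=> h0 incg; have [ql [qr [ql0 qr0 qg [kap [kap0 kapf kapE]]]]] := rate_split i.
exists ql, qr; split=> //.
have eE (xi : spins) : euler h (spin ^~ i.+1) xi =
    spin xi i.+1 - h * (2 * (spin xi i.+1 * glauber_rate xi i)).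
  rewrite /euler (bigD1 i) //= big1 => [|j ji].
    by rewrite spin_flip_same; ring.
  by rewrite spin_flip_other ?subrr ?mulr0 // eqSS eq_sym.
pose Y := \sum_xi gibbs xi * g xi * (kap xi * (spin xi i.+1 * glauber_rate xi i)).
have -> : dot g (euler h (spin ^~ i.+1)) = dot g (spin ^~ i.+1) -
    h * (s ^+ 2 - 1) * (dot g (spin ^~ i.+1) - ql * dot g (spin ^~ i) -
                        qr * dot g (spin ^~ i.+2)) - h * Y.
  rewrite /Y /dot !mulr_sumr -!sumrB mulr_sumr -!sumrB.
  by apply: eq_bigr => xi _; rewrite eE kapE; ring.
rewrite gerBl mulr_ge0 //.
(* Average [Y] with its image under the flip at [i]: weight times rate and [kap] are invariant and
   the spin changes sign, which leaves the increment of [g] times the spin. Monotonicity makes this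
   nonnegative. *)
have -> : Y = 2^-1 * \sum_xi gibbs xi * glauber_rate xi i * kap xi *
    (spin xi i.+1 * (g xi - g (flip xi i))).
  pose Z (xi : spins) := gibbs xi * glauber_rate xi i * kap xi * (spin xi i.+1 * g xi).
  have YE : Y = \sum_xi Z xi by apply: eq_bigr => xi _; rewrite /Z; ring.
  have YE' : Y = \sum_xi Z (flip xi i) by rewrite YE (reindex_inj (inv_inj (flipK i))).
  apply: (mulfI (_ : 2 != 0)); first by rewrite pnatr_eq0.
  rewrite mulrA mulfV ?pnatr_eq0 // mul1r mulr_natl mulr2n {1}YE YE' -big_split /=.
  apply: eq_bigr => xi _.
  by rewrite /Z -detailed_balance kapf spin_flip_same; ring.
rewrite mulr_ge0 ?invr_ge0 //; apply: sumr_ge0 => xi _.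
apply: mulr_ge0.
  by rewrite mulr_ge0 // mulr_ge0 ?glauber_rate_ge0 // (ltW (gibbs_gt0 _)).
rewrite spin_ord /sgb; case xE: (xi i) => /=.
  rewrite mul1r subr_ge0; apply: incg => j; rewrite ffunE.
  by case: eqP => [->|_]; [rewrite xE|exact: implybb].
rewrite mulN1r opprB subr_ge0; apply: incg => j; rewrite ffunE.
by case: eqP => [->|_]; [rewrite xE|exact: implybb].
Qed.

Definition all_up : spins := [ffun=> true].

Lemma le_all_up xi : spins_le xi all_up.
Proof. by move=> i; rewrite ffunE implybT. Qed.

(** Up to the factor [gibbs all_up], the density of the point mass at the all-plus state. *)
Definition up_ind xi : R := (xi == all_up)%:R.

Lemma dot_up_ind f : dot up_ind f = gibbs all_up * f all_up.
Proof.
rewrite /dot (bigD1 all_up) //= /up_ind eqxx mulr1 big1 ?addr0 // => xi /negPf->.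
by rewrite mulr0 mul0r.
Qed.

Lemma up_ind_increasing : increasing up_ind.
Proof.
move=> xi zeta le; rewrite /up_ind; case: eqP => [xE|_]; last exact: ler0n.
rewrite (_ : zeta = all_up) ?eqxx //.
by apply/ffunP => i; have := le i; rewrite xE !ffunE.
Qed.

Lemma step_decay_ge0 h : (0 < N)%N -> small_step h ->
  [/\ 0 <= 1 - h * (s ^+ 2 - 1) & 0 <= 1 - h * decay_rate].
Proof.
move=> N0 [h0 hN]; have s1 := s_gt1; have g1 := gam_lt1.
have g0 : 0 <= gam by apply: le_trans gam_ge; rewrite invr_ge0; lra.
have p : 0 <= s ^+ 2 - 1 by rewrite expr2; nra.
have q : h * (s ^+ 2 - 1) <= 1.
  apply: le_trans hN; apply: ler_pM => //; last by rewrite !expr2; nra.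
  by rewrite ler_peMr // ler1n.
split; first by lra.
have : h * decay_rate <= h * (s ^+ 2 - 1).
  by rewrite ler_wpM2l // /decay_rate ler_piMr //; lra.
by lra.
Qed.

(** Symmetry of [dot] moves the iteration from the spin to the density [up_ind], whose iterates stay
    increasing, so that [dot_euler_spin] applies at every step. *)
Lemma spin_decay h k i : small_step h ->
  iter k (euler h) (spin ^~ i.+1) all_up <= (1 - h * decay_rate) ^+ k.
Proof.
move=> hs; have N0 : (0 < N)%N by exact: leq_ltn_trans (leq0n _) (ltn_ord i).
have [h1 h2] := step_decay_ge0 N0 hs; have [h0 _] := hs.
have s1 := s_gt1.
have p : 0 <= s ^+ 2 - 1 by rewrite expr2; nra.
have W0 := gibbs_gt0 all_up.
rewrite -(ler_pM2l W0) -dot_up_ind iter_euler_sym.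
(* The mean at one position involves those of its neighbours, so the induction treats all positions
   together; outside the box the mean is [0]. *)
have: forall y, dot (iter k (euler h) up_ind) (spin ^~ y) <=
    gibbs all_up * (1 - h * decay_rate) ^+ k; last exact.
elim: k => [|k IH] y.
  by rewrite /= dot_up_ind expr0 ler_pM2l //; have /andP[] := spin_bound all_up y.
have [yout|[j yE _]] := spinP all_up y.
  rewrite /dot big1 => [|xi _]; first by rewrite mulr_ge0 ?exprn_ge0 // ltW.
  have [[_ ->]|[j yE _]] := spinP xi y; first by rewrite mulr0.
  by case: yout => [[e|e] _]; exfalso; have := ltn_ord j; lia.
rewrite yE iterS -euler_sym.
have incg := iter_euler_increasing k hs up_ind_increasing.
have [ql [qr [ql0 qr0 qg /le_trans]]] := dot_euler_spin j h0 incg; apply.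
set T := gibbs all_up * _ in IH.
have -> : gibbs all_up * (1 - h * decay_rate) ^+ k.+1 = (1 - h * decay_rate) * T.
  by rewrite [_ ^+ k.+1]exprS mulrCA.
set m := dot _ _ ; set a := dot _ _; set b := dot _ _.
have T0 : 0 <= T by rewrite mulr_ge0 ?exprn_ge0 // ltW.
have mT : m <= T by exact: IH.
have aT : ql * a <= ql * T by rewrite ler_wpM2l ?IH.
have bT : qr * b <= qr * T by rewrite ler_wpM2l ?IH.
have qT : (ql + qr) * T <= gam * T by rewrite ler_wpM2r.
have -> : m - h * (s ^+ 2 - 1) * (m - ql * a - qr * b) =
  (1 - h * (s ^+ 2 - 1)) * m + h * (s ^+ 2 - 1) * (ql * a + qr * b) by ring.
have -> : (1 - h * decay_rate) * T = (1 - h * (s ^+ 2 - 1)) * T +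
  h * (s ^+ 2 - 1) * (gam * T) by rewrite /decay_rate; ring.
apply: lerD; rewrite ler_wpM2l ?mulr_ge0 //.
by apply: le_trans qT; rewrite mulrDl lerD.
Qed.

(** * Oscillation of local functions *)

Definition local_on (D : {set 'I_N}) g :=
  forall xi zeta, {in D, xi =1 zeta} -> g xi = g zeta.

Definition magnetization (D : {set 'I_N}) xi : R := \sum_(i in D) spin xi i.+1.

(** If a spin of [D] goes up, [B * magnetization D] gains at least [2 * B], which is the most that
    [g] can lose; if none does, [g] is unchanged. *)
Lemma magnetizationD_increasing (D : {set 'I_N}) g (B : R) :
  (forall xi, `|g xi| <= B) -> local_on D g ->
  increasing (fun x => B * magnetization D x + g x).
Proof.
move=> gB gD xi zeta le.
have B0 : 0 <= B by apply: le_trans (gB xi); exact: normr_ge0.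
have [agree|] := boolP [forall i in D, xi i == zeta i].
  have xz : {in D, xi =1 zeta} by move=> i /(forall_inP agree) /eqP.
  rewrite (gD _ _ xz) lerD2r ler_wpM2l //; apply: ler_sum => i _.
  exact: spin_le_spins.
case/forall_inPn => i iD ne.
have d : magnetization D xi + 2 <= magnetization D zeta.
  rewrite /magnetization !(bigD1 i iD) /= addrAC; apply: lerD.
    rewrite !spin_ord; have := le i.
    by move: ne; case: (xi i); case: (zeta i) => //= _ _; rewrite /sgb; lra.
  by apply: ler_sum => j _; exact: spin_le_spins.
have := gB xi; have := gB zeta; rewrite !ler_norml => /andP[a b] /andP[c e].
have : B * (magnetization D xi + 2) <= B * magnetization D zeta by rewrite ler_wpM2l.
by lra.
Qed.

Lemma magnetization_decay h k (D : {set 'I_N}) : small_step h ->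
  iter k (euler h) (magnetization D) all_up <= #|D|%:R * (1 - h * decay_rate) ^+ k.
Proof.
move=> hs; rewrite iter_euler_sum mulr_natl -sumr_const.
by apply: ler_sum => i _; exact: spin_decay.
Qed.

Lemma iter_magnetization_odd h k (D : {set 'I_N}) xi :
  iter k (euler h) (magnetization D) (flip_all xi) =
  - iter k (euler h) (magnetization D) xi.
Proof.
rewrite -[LHS]/((iter k (euler h) (magnetization D) \o flip_all) xi).
rewrite -iter_euler_flip_all -mulN1r -iter_eulerZ; congr (iter k _ _ _).
apply: funext => x; rewrite /= mulN1r -sumrN.
by apply: eq_bigr => i _; exact: spin_flip_all.
Qed.

(** Monotonicity of [B * magnetization D + g] compares any state with [all_up], and the
    magnetization started anywhere is at least minus its value from [all_up]. This gives [2 * B]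
    times the latter for each state, hence the [4] for two states. *)
Lemma osc_decay h k (D : {set 'I_N}) g (B : R) xi zeta : small_step h ->
  (forall xi, `|g xi| <= B) -> local_on D g ->
  `|iter k (euler h) g xi - iter k (euler h) g zeta| <=
    4 * B * #|D|%:R * (1 - h * decay_rate) ^+ k.
Proof.
move=> hs gB gD; set T := (1 - _) ^+ k.
have B0 : 0 <= B by apply: le_trans (gB xi); exact: normr_ge0.
pose m := iter k (euler h) (magnetization D).
have mT : m all_up <= #|D|%:R * T by exact: magnetization_decay.
have m_incr : increasing m.
  apply: iter_euler_increasing => // x y le.
  by apply: ler_sum => i _; exact: spin_le_spins.
have mlow x : - m x <= m all_up.
  by rewrite -iter_magnetization_odd; exact/m_incr/le_all_up.
have up f : (forall x, `|f x| <= B) -> local_on D f -> forall x,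
    iter k (euler h) f x - iter k (euler h) f all_up <= 2 * (B * m all_up).
  move=> fB fD x.
  have := iter_euler_increasing k hs (magnetizationD_increasing fB fD) (le_all_up x).
  rewrite !iter_eulerD !iter_eulerZ -/m.
  have : B * - m x <= B * m all_up by rewrite ler_wpM2l.
  by rewrite mulrN; lra.
have dist x : `|iter k (euler h) g x - iter k (euler h) g all_up| <= 2 * (B * m all_up).
  rewrite ler_norml up // andbT.
  (* The lower bound is the upper bound for [- g]. *)
  have := up (fun y => -1 * g y) _ _ x; rewrite !iter_eulerZ.
  have p1 y : `|-1 * g y| <= B by rewrite normrM normrN normr1 mul1r.
  have p2 : local_on D (fun y => -1 * g y) by move=> y z yz; rewrite (gD _ _ yz).
  by move=> /(_ p1 p2); lra.
have : B * m all_up <= B * (#|D|%:R * T) by rewrite ler_wpM2l.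
have := dist xi; have := dist zeta.
rewrite !ler_norml => /andP[a b] /andP[c e] f; apply/andP; split; lra.
Qed.

(** * Stability of Euler steps and spread of influence *)

Lemma small_step_rate h xi : small_step h -> h * \sum_i glauber_rate xi i <= 1.
Proof.
move=> [h0 hN].
have : \sum_i glauber_rate xi i <= N%:R * rate_max.
  rewrite mulr_natl -[X in _ *+ X]card_ord -sumr_const.
  by apply: ler_sum => i _; exact: glauber_rate_max.
move/(ler_wpM2l h0) => /le_trans; apply.
move: hN; rewrite /rate_max; have : 0 <= h * N%:R * (s + 1) ^+ 2.
  by rewrite mulr_ge0 ?sqr_ge0 // mulr_ge0.
by lra.
Qed.

(** Under [small_step] the total flip probability is at most [1], so an Euler step takes convex
    combinations of values. *)
Lemma iter_euler_bound h k g (B : R) : small_step h ->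
  (forall xi, `|g xi| <= B) -> forall xi, `|iter k (euler h) g xi| <= B.
Proof.
move=> hs gB; elim: k => // k IH xi; rewrite iterS.
have [h0 _] := hs; have B0 : 0 <= B by apply: le_trans (gB xi); exact: normr_ge0.
set f := iter k _ g in IH *.
have r1 := small_step_rate xi hs.
have -> : euler h f xi = (1 - h * \sum_i glauber_rate xi i) * f xi +
    \sum_i h * glauber_rate xi i * f (flip xi i).
  rewrite mulrBl mul1r -addrA -[h * _ * f xi]mulrA mulr_suml !mulr_sumr addrC.
  by rewrite /euler addrC mulr_sumr -sumrN -big_split; congr (_ + _); apply: eq_bigr => i _ /=; ring.
apply: (le_trans (ler_normD _ _)).
have -> : B = (1 - h * \sum_i glauber_rate xi i) * B +
    \sum_i h * glauber_rate xi i * B by rewrite -mulr_suml -mulr_sumr; ring.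
apply: lerD.
  by rewrite normrM ger0_norm ?subr_ge0 // ler_wpM2l ?subr_ge0.
apply: (le_trans (ler_norm_sum _ _ _)); apply: ler_sum => i _.
have p : 0 <= h * glauber_rate xi i by rewrite mulr_ge0 ?glauber_rate_ge0.
by rewrite normrM ger0_norm // ler_wpM2l.
Qed.

Lemma sum_eq_nat_le1 (n : nat) : \sum_(j < N) ((j == n :> nat)%:R : R) <= 1.
Proof.
have [nN|nN] := ltnP n N.
  rewrite (bigD1 (Ordinal nN)) //= eqxx big1 ?addr0 // => j jn.
  by rewrite (_ : _ == _ = false) //; apply/negbTE.
rewrite big1 ?ler01 // => j _.
by rewrite (_ : _ == _ = false) //; apply/negbTE; have := ltn_ord j; lia.
Qed.

Definition flip_lipschitz (w : 'I_N -> R) g := forall i xi, `|g (flip xi i) - g xi| <= w i.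

(** Finite speed of propagation: a flip at [x] alters at most three rates, each by at most
    [rate_max], and the weights there are at most [2 * w x]. This is the [6]. *)
Lemma euler_lipschitz h g (w : 'I_N -> R) : small_step h ->
  (forall i j, (i.+1 = j)%N \/ (j.+1 = i)%N -> w j <= 2 * w i) ->
  flip_lipschitz w g ->
  flip_lipschitz (fun i => (1 + 6 * rate_max * h) * w i) (euler h g).
Proof.
move=> hs w2 gw x xi; have [h0 _] := hs.
have w0 i : 0 <= w i by apply: le_trans (gw i xi); exact: normr_ge0.
set xi' := flip xi x; have r1 := small_step_rate xi hs.
(* Three contributions: no flip, the same flip from both states, and the discrepancy of the
   rates. *)
have -> : euler h g xi' - euler h g xi =
    (1 - h * \sum_i glauber_rate xi i) * (g xi' - g xi) +
    \sum_i h * glauber_rate xi i * (g (flip xi' i) - g (flip xi i)) +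
    \sum_i h * (glauber_rate xi' i - glauber_rate xi i) * (g (flip xi' i) - g xi').
  rewrite mulrBl mul1r mulr_sumr mulr_suml.
  transitivity (g xi' - g xi + \sum_i (h * (glauber_rate xi' i * (g (flip xi' i) - g xi')) -
      h * (glauber_rate xi i * (g (flip xi i) - g xi)))).
    by rewrite /euler !mulr_sumr sumrB; ring.
  rewrite -!addrA; congr (_ + (_ + _)); rewrite -sumrN -!big_split /=.
  by apply: eq_bigr => i _; ring.
have -> : (1 + 6 * rate_max * h) * w x =
    ((1 - h * \sum_i glauber_rate xi i) * w x +
    \sum_i h * glauber_rate xi i * w x) + h * rate_max * (2 * w x) * (1 + 1 + 1).
  by rewrite -mulr_suml -mulr_sumr; ring.
apply: (le_trans (ler_normD _ _)); apply: lerD.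
  apply: (le_trans (ler_normD _ _)); apply: lerD.
    by rewrite normrM ger0_norm ?subr_ge0 // ler_wpM2l ?subr_ge0 //; exact: gw.
  apply: (le_trans (ler_norm_sum _ _ _)); apply: ler_sum => i _.
  have p : 0 <= h * glauber_rate xi i by rewrite mulr_ge0 ?glauber_rate_ge0.
  by rewrite normrM ger0_norm // ler_wpM2l // /xi' flip_comm; exact: gw.
apply: (le_trans (ler_norm_sum _ _ _)).
have C0 : 0 <= h * rate_max * (2 * w x) by rewrite mulr_ge0 // mulr_ge0 // rate_max_ge0.
(* For [x = 0] the predecessor is [0] again, so that site counts twice; this only enlarges the
   bound. *)
apply: (@le_trans _ _ (\sum_(i < N) h * rate_max * (2 * w x) *
    ((i == x :> nat)%:R + (i == x.+1 :> nat)%:R + (i == x.-1 :> nat)%:R))).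
  apply: ler_sum => i _; rewrite !normrM (ger0_norm h0).
  have close : (i == x :> nat) || (i == x.+1 :> nat) || (i.+1 == x :> nat) ->
      h * `|glauber_rate xi' i - glauber_rate xi i| * `|g (flip xi' i) - g xi'| <=
      h * rate_max * (2 * w x) * 1.
    move=> nx; rewrite mulr1; apply: ler_pM => //; first by rewrite mulr_ge0.
      rewrite ler_wpM2l // ler_norml.
      have a := glauber_rate_ge0 xi i; have b := glauber_rate_max xi i.
      have c := glauber_rate_ge0 xi' i; have d := glauber_rate_max xi' i.
      by apply/andP; split; lra.
    apply: (le_trans (gw i xi')); case/orP: nx => [/orP[/eqP ix|/eqP ix]|/eqP ix].
    - by rewrite (ord_inj ix); have := w0 x; lra.
    - by apply: w2; left.
    - by apply: w2; right.
  have [ix|ix] := eqVneq (i : nat) (x : nat).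
    apply: le_trans (close _) _; first by rewrite ix eqxx.
    by rewrite ler_wpM2l // -addrA lerDl addr_ge0.
  have [ix1|ix1] := eqVneq (i : nat) x.+1.
    apply: le_trans (close _) _; first by rewrite ix1 eqxx orbT.
    by rewrite ler_wpM2l // add0r lerDl.
  have [ix2|ix2] := eqVneq (i.+1 : nat) x.
    apply: le_trans (close _) _; first by rewrite ix2 eqxx orbT.
    by rewrite ler_wpM2l // -ix2 /= eqxx !add0r.
  rewrite glauber_rate_far // subrr normr0 mulr0 mul0r.
  by rewrite mulr_ge0 // !addr_ge0.
rewrite -mulr_sumr ler_wpM2l // !big_split /=.
by rewrite !lerD // sum_eq_nat_le1.
Qed.

Lemma iter_euler_lipschitz h k g (w : 'I_N -> R) : small_step h ->
  (forall i j, (i.+1 = j)%N \/ (j.+1 = i)%N -> w j <= 2 * w i) ->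
  flip_lipschitz w g ->
  flip_lipschitz (fun i => (1 + 6 * rate_max * h) ^+ k * w i) (iter k (euler h) g).
Proof.
move=> hs w2 gw; elim: k => [|k IH] i xi; first by rewrite expr0 mul1r; exact: gw.
rewrite exprS -mulrA.
apply: (@euler_lipschitz h _ (fun i => (1 + 6 * rate_max * h) ^+ k * w i)) => // a b ab.
have [h0 _] := hs.
have p : 0 <= 1 + 6 * rate_max * h by rewrite addr_ge0 // mulr_ge0 // mulr_ge0 // rate_max_ge0.
rewrite /= [X in _ <= X]mulrCA ler_wpM2l ?exprn_ge0 //.
exact: w2.
Qed.

Lemma dot_iter_euler h k g : dot (fun=> 1) (iter k (euler h) g) = dot (fun=> 1) g.
Proof. by rewrite iter_euler_sym iter_euler_cst. Qed.

End Box.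
Arguments spin : simpl never.

(** * Edge spins of a particle configuration *)

Section Lift.
Set Implicit Arguments.
Unset Strict Implicit.
Context (n : nat).

Definition box_size := (n + n).+2.
Notation N := box_size.
(** The box has the vertices [- n .. n], the edges between them and one edge
    sticking out on each side: edge number [i] joins [i - n - 1] and [i - n]. *)
Definition vertex (j : nat) : int := j%:Z - n%:Z.
Implicit Types (eta zeta : config) (xi : spins N) (i : 'I_N).

(** The edge spins are determined by [zeta] up to a global flip, which is fixed
    by taking the leftmost spin to be [true]. *)
Fixpoint lift_spin zeta (k : nat) : bool :=
  if k is k'.+1 then lift_spin zeta k' == zeta (vertex k') else true.

Definition lift_config zeta : spins N := [ffun i : 'I_N => lift_spin zeta i].

Definition spin_at xi (k : nat) : bool := oapp xi true (insub k).

Definition config_of_spins xi : config := fun x =>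
  if (- n%:Z <= x <= n%:Z) then
    spin_at xi (absz (x + n%:Z)) == spin_at xi (absz (x + n%:Z)).+1 else false.

Lemma spin_at_lift zeta k : (k < N)%N -> spin_at (lift_config zeta) k = lift_spin zeta k.
Proof. by move=> kN; rewrite /spin_at insubT /= ffunE. Qed.

Lemma spin_at_ord xi i : spin_at xi i = xi i.
Proof. by rewrite /spin_at valK. Qed.

Lemma unlift_vertex xi (j : nat) : (j <= n + n)%N ->
  config_of_spins xi (vertex j) = (spin_at xi j == spin_at xi j.+1).
Proof.
move=> jn; rewrite /config_of_spins /vertex ifT; last by apply/andP; split; lia.
by rewrite subrK.
Qed.

Lemma vertexP (x : int) : - n%:Z <= x <= n%:Z ->
  exists2 j, (j <= n + n)%N & x = vertex j.
Proof. by move=> /andP[a b]; exists (absz (x + n%:Z)); rewrite /vertex; lia. Qed.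

Lemma unlift_lift zeta (x : int) : - n%:Z <= x <= n%:Z -> config_of_spins (lift_config zeta) x = zeta x.
Proof.
case/vertexP => j jn ->; rewrite unlift_vertex // !spin_at_lift /box_size; try lia.
by rewrite /=; case: (lift_spin _ _); case: (zeta _).
Qed.

Lemma unlift_flip_all xi : config_of_spins (flip_all xi) = config_of_spins xi.
Proof.
apply: funext => x; rewrite /config_of_spins; case: ifPn => // /andP[a b].
have E k : (k < N)%N -> spin_at (flip_all xi) k = ~~ spin_at xi k.
  by move=> kN; rewrite /spin_at !insubT /= ffunE.
rewrite !E /box_size; lia.
Qed.

(** The fibre of the lift over [xi] is a cylinder on the window if the leftmost spin is up, and
    empty otherwise. *)
Lemma liftP zeta xi : lift_config zeta = xi <->
  xi ord0 /\ (forall j, (j <= n + n)%N -> zeta (vertex j) = config_of_spins xi (vertex j)).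
Proof.
split=> [<-|[x0 xz]].
  split=> [|j jn]; first by rewrite ffunE.
  by rewrite unlift_lift // /vertex; apply/andP; split; lia.
apply/ffunP => -[k kN]; rewrite ffunE /=.
rewrite -[RHS]spin_at_ord /=.
elim: k kN => [|k IH] kN.
  by rewrite /= /spin_at insubT /= -x0; congr (xi _); exact: val_inj.
rewrite /= IH; last exact: ltnW.
rewrite xz ?unlift_vertex; [|move: kN; rewrite /box_size; lia..].
by case: (spin_at xi k); case: (spin_at xi k.+1).
Qed.

Lemma eq_lift zeta eta : (forall j, (j <= n + n)%N -> zeta (vertex j) = eta (vertex j)) ->
  lift_config zeta = lift_config eta.
Proof.
move=> ze; apply/liftP; split; first by rewrite ffunE.
by move=> j jn; rewrite ze // unlift_lift // /vertex; apply/andP; split; lia.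
Qed.

(** Edge [i] joins the two flipped vertices: the first changes spin [i], and the second restores all
    spins after it. *)
Lemma lift_spin_flip zeta (i : nat) k : (0 < i)%N ->
  lift_spin (double_flip zeta (vertex i - 1)) k = lift_spin zeta k (+) (k == i).
Proof.
move=> i0; elim: k => [|k IH]; first by rewrite /= (ltn_eqF i0).
rewrite /= IH /double_flip /vertex.
have -> : (k%:Z - n%:Z == i%:Z - n%:Z - 1) = (k.+1 == i).
  by apply/eqP/eqP; lia.
have -> : (k%:Z - n%:Z == i%:Z - n%:Z - 1 + 1) = (k == i).
  by apply/eqP/eqP; lia.
have [->|ki] := eqVneq k i.
  by rewrite orbT (gtn_eqF (ltnSn _)); case: (lift_spin _ _); case: (zeta _).
by rewrite orbF; case: (k.+1 == i); case: (lift_spin _ _); case: (zeta _).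
Qed.

(** Only the right end of edge [0] lies in the window. The leftmost spin is pinned to [true], so all
    the others change instead: a single flip up to a global one, invisible to even functions. *)
Lemma lift_spin_flip0 zeta k :
  lift_spin (double_flip zeta (vertex 0 - 1)) k = lift_spin zeta k (+) (k != 0%N).
Proof.
elim: k => [|k IH] //; rewrite /= IH /double_flip /vertex.
have -> : (k%:Z - n%:Z == 0%:Z - n%:Z - 1) = false by apply/eqP; lia.
have -> : (k%:Z - n%:Z == 0%:Z - n%:Z - 1 + 1) = (k == 0%N) by apply/eqP/eqP; lia.
by case: (eqVneq k 0%N) => [->|k0] /=; [|case: (lift_spin zeta k)]; case: (zeta _).
Qed.

Lemma lift_double_flip zeta i : i != ord0 ->
  lift_config (double_flip zeta (vertex i - 1)) = flip (lift_config zeta) i.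
Proof.
move=> i0; apply/ffunP => j; rewrite !ffunE lift_spin_flip ?lt0n //.
by rewrite -(inj_eq val_inj); case: eqP => _; rewrite ?addbF ?addbT.
Qed.

Lemma lift_double_flip0 zeta :
  lift_config (double_flip zeta (vertex (ord0 : 'I_N) - 1)) = flip_all (flip (lift_config zeta) ord0).
Proof.
apply/ffunP => j; rewrite !ffunE lift_spin_flip0 -(inj_eq val_inj) /=.
by case: eqP => _; rewrite ?addbF ?addbT ?negbK.
Qed.

Lemma lift_double_flip_out zeta (x : int) :
  (forall i, x != vertex i - 1) -> lift_config (double_flip zeta x) = lift_config zeta.
Proof.
move=> xo; apply: eq_lift => j jn; rewrite /double_flip.
have [xj|xj] := eqVneq (vertex j) x.
  have jN : (j.+1 < N)%N by rewrite /box_size; lia.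
  by have /eqP[] := xo (Ordinal jN); rewrite -xj /vertex /=; lia.
have [xj1|//] := eqVneq (vertex j) (x + 1).
have jN : (j < N)%N by rewrite /box_size; lia.
by have /eqP[] := xo (Ordinal jN); rewrite /= xj1; ring.
Qed.

End Lift.

(** * Local functions on the configuration space *)

Section LocalFunctions.
Set Implicit Arguments.
Unset Strict Implicit.
Implicit Types (eta zeta : config) (A : set config).

Definition update eta (x : int) (b : bool) : config :=
  fun y => if y == x then b else eta y.

Lemma measurable_occupied (x : int) :
  measurable ([set eta : config | eta x] : set config_meas).
Proof. by apply: sub_sigma_algebra; exists x. Qed.

Lemma measurable_cylinder (D : seq int) A :
  (forall eta zeta, {in D, forall x, eta x = zeta x} -> A eta -> A zeta) ->
  measurable (A : set config_meas).
Proof.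
elim: D A => [|x D IH] A loc.
  have [[eta Aeta]|noA] := pselect (exists eta, A eta).
    rewrite (_ : A = setT); first exact: measurableT.
    by apply/seteqP; split=> // zeta _; exact: loc Aeta.
  rewrite (_ : A = set0); first exact: measurable0.
  by apply/seteqP; split=> // zeta Az; apply: noA; exists zeta.
(* Freezing the coordinate [x] at [b] leaves a set that depends only on the remaining
   coordinates. *)
pose S b := [set eta | A (update eta x b)].
have mS b : measurable (S b : set config_meas).
  apply: IH => eta zeta ez; apply: loc => y; rewrite inE /update.
  by case: eqP => //= _ /ez.
have mO := measurable_occupied x.
rewrite (_ : A = (S true `&` [set eta | eta x]) `|`
                 (S false `&` ~` [set eta | eta x])).
  apply: measurableU; apply: measurableI => //.
  exact: measurableC.
have self eta : update eta x (eta x) = eta.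
  by apply: funext => y; rewrite /update; case: eqP => // ->.
apply/seteqP; split=> eta.
  move=> Aeta; have [ex|ex] := boolP (eta x).
    by left; split=> //; rewrite /S /= -ex self.
  by right; split=> //=; [rewrite /S /= -(negbTE ex) self|exact/negP].
case=> -[]; rewrite /S /= => + ex.
  by rewrite -ex self.
by move/negP: ex => /negbTE <-; rewrite self.
Qed.

Lemma local_funW (R : Type) (S : Type) (f : config -> R) (g : R -> S) :
  local_fun f -> local_fun (g \o f).
Proof. by move=> [D fD]; exists D => eta zeta ez; rewrite /= (fD _ _ ez). Qed.

Lemma measurable_local (R : realType) (f : config -> R) :
  local_fun f -> measurable_fun setT (f : config_meas -> R).
Proof.
move=> [D fD] _ Y mY; rewrite setTI; apply: (@measurable_cylinder D).
by move=> eta zeta ez; rewrite /preimage /= (fD _ _ ez).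
Qed.

Lemma near_agree (D : seq int) zeta :
  \forall eta \near zeta, {in D, forall x, eta x = zeta x}.
Proof.
elim: D => [|x D IH]; first by near=> eta => y; rewrite in_nil.
have nx : \forall eta \near zeta, eta x = zeta x.
  have h := @proj_continuous int (fun=> bool) x zeta [set b | b = zeta x].
  by apply: h; exact: (@discrete_set1 bool).
near=> eta => y; rewrite inE => /predU1P[->|]; first by near: eta.
by move: y; near: eta.
Unshelve. all: by end_near. Qed.

Lemma local_continuous (R : realType) (f : config -> R) :
  local_fun f -> continuous f.
Proof.
move=> [D fD] zeta; apply: cvg_near_cst.
by apply: filterS (near_agree D zeta) => eta ez; exact: fD.
Qed.

Definition truncate (n : nat) zeta : config :=
  fun x => if (absz x <= n)%N then zeta x else false.

Lemma cvg_truncate zeta : truncate ^~ zeta @ \oo --> zeta.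
Proof.
apply/cvg_sup => x U /= [V [[W oW <-] Wz] VU].
exists (absz x) => // n /= xn; apply: VU => /=.
by rewrite /= /truncate xn.
Qed.

(** A continuous function is the pointwise limit of its compositions with [truncate n], which are
    local. This turns the Feller property into measurability for the product sigma-algebra. *)
Lemma measurable_continuous (R : realType) (f : config -> R) :
  continuous f -> measurable_fun setT (f : config_meas -> R).
Proof.
move=> cf; apply: (@measurable_realfun.measurable_fun_cvg _ config_meas R setT
  (fun n => f \o truncate n : config_meas -> R)).
  move=> n; apply: measurable_local.
  exists [seq (k%:Z - n%:Z : int) | k <- iota 0 (n + n).+1] => eta zeta ez.
  congr f; apply: funext => x; rewrite /truncate; case: leqP => // xn; apply: ez.
  apply/mapP; exists (absz (x + n%:Z)); first by rewrite mem_iota; lia.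
  by lia.
move=> zeta _; apply: continuous_cvg; first exact: cf.
exact: cvg_truncate.
Qed.

End LocalFunctions.

(** * Comparison of the process with the finite box *)

Section Process.
Set Implicit Arguments.
Unset Strict Implicit.

Lemma probability_bounded_integrable d (T : measurableType d) (R : realType)
    (mu : probability T R) (f : T -> R) (M : R) :
  measurable_fun setT f -> (forall x, `|f x| <= M) ->
  mu.-integrable setT (EFin \o f).
Proof.
move=> mf fM; apply: measurable_bounded_integrable => //.
  by rewrite (le_lt_trans (probability_le1 _ _)) // ltry.
exists M; split; first exact: num_real.
by move=> y My x _; exact: le_trans (fM x) (ltW My).
Qed.

Lemma Rintegral_probability_cst d (T : measurableType d) (R : realType)
    (mu : probability T R) (c : R) : (\int[mu]_x c = c)%R.
Proof.
rewrite Rintegral_cst // (_ : fine _ = 1) ?mulr1 //.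
exact: (congr1 fine (probability_setT mu)).
Qed.

Lemma normr_Rintegral_le d (T : measurableType d) (R : realType)
    (mu : probability T R) (f : T -> R) (M : R) :
  measurable_fun setT f -> (forall x, `|f x| <= M) -> `|\int[mu]_x f x|%R <= M.
Proof.
move=> mf fM; have intf := probability_bounded_integrable mu mf fM.
apply: (le_trans (le_normr_Rintegral measurableT intf)).
rewrite -[leRHS](Rintegral_probability_cst mu); apply: le_Rintegral => //.
- apply: (@probability_bounded_integrable _ _ _ _ _ M).
    exact: (measurableT_comp (@normr_measurable R setT) mf).
  by move=> x; rewrite normr_id.
- exact: (@probability_bounded_integrable _ _ _ _ _ `|M|).
Qed.

Lemma Rintegral_bounded_sum d (T : measurableType d) (R : realType)
    (mu : probability T R) (I : Type) (r : seq I) (F : I -> T -> R) (M : I -> R) :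
  (forall i, measurable_fun setT (F i)) -> (forall i x, `|F i x| <= M i) ->
  (\int[mu]_x (\sum_(i <- r) F i x) = \sum_(i <- r) \int[mu]_x F i x)%R.
Proof.
move=> mF FM; elim: r => [|i r IH].
  rewrite big_nil -[RHS](mul0r (fine (mu setT))) -Rintegral_cst //.
  by congr Rintegral; apply: funext => x; rewrite big_nil.
rewrite big_cons -IH -RintegralD //.
- by congr Rintegral; apply: funext => x; rewrite big_cons.
- exact: probability_bounded_integrable (mF i) (FM i).
- apply: (@probability_bounded_integrable _ _ _ _ _ (\sum_(j <- r) M j)).
    exact: measurable_sum.
  by move=> x; apply: (le_trans (ler_norm_sum _ _ _)); exact: ler_sum.
Qed.

Context {R : realType} (lambda : R) d (Omega : measurableType d)
  (P : config -> probability Omega R) (X : R -> Omega -> config)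
  (HX : is_dfp lambda P X) (n : nat).
Implicit Types (eta zeta : config) (G : spins (box_size n) -> R).

Lemma lift_local : local_fun (lift_config n).
Proof.
exists [seq vertex n k | k <- iota 0 (n + n).+1] => eta zeta ez.
by apply: eq_lift => j jn; apply: ez; apply/mapP; exists j; rewrite // mem_iota.
Qed.

Definition lift_event (xi : spins (box_size n)) : set config := [set zeta | lift_config n zeta = xi].

Lemma measurable_lift_event xi : measurable (lift_event xi : set config_meas).
Proof.
have [D loc] := lift_local; apply: (@measurable_cylinder D) => eta zeta ez.
by rewrite /lift_event /= (loc _ _ ez).
Qed.

Lemma measurable_X_event t (A : set config_meas) : 0 <= t -> measurable A ->
  measurable (X t @^-1` A).
Proof. by move=> t0 mA; rewrite -[_ @^-1` _]setTI; exact: (dfp_measurable HX t0). Qed.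

Lemma Rintegral_lift d' (T : measurableType d') (mu : probability T R)
    (Y : T -> config_meas) G : measurable_fun setT Y ->
  (\int[mu]_w G (lift_config n (Y w)) = \sum_xi G xi * fine (mu (Y @^-1` lift_event xi)))%R.
Proof.
move=> mY; have mA xi : measurable (Y @^-1` lift_event xi).
  by rewrite -[_ @^-1` _]setTI; apply: mY => //; exact: measurable_lift_event.
transitivity (\int[mu]_w (\sum_xi G xi * \1_(Y @^-1` lift_event xi) w))%R.
  congr Rintegral; apply: funext => w; rewrite (bigD1 (lift_config n (Y w))) //=.
  rewrite indicE mem_set // mulr1 big1 ?addr0 // => xi ne.
  by rewrite indicE memNset ?mulr0 // => e; move/eqP: ne; apply; exact: esym e.
rewrite (@Rintegral_bounded_sum _ _ _ _ _ _ _ (fun xi => `|G xi|)).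
- apply: eq_bigr => xi _; rewrite RintegralZl //.
    by rewrite /Rintegral integral_indic // setIT.
  apply: (@probability_bounded_integrable _ _ _ _ _ 1).
    exact: measurable_indic.
  by move=> x; rewrite indicE; case: (_ \in _); rewrite ?normr1 ?normr0.
- by move=> xi; apply: measurable_funM => //; exact: measurable_indic.
- move=> xi x; rewrite normrM indicE; case: (_ \in _).
    by rewrite normr1 mulr1.
  by rewrite normr0 mulr0.
Qed.

Lemma expect_lift eta t G : 0 <= t -> expect_from P X eta t (G \o lift_config n) =
  \sum_xi G xi * fine (P eta (X t @^-1` lift_event xi)).
Proof. by move=> t0; exact/Rintegral_lift/(dfp_measurable HX). Qed.

Lemma expect_lift_ind eta t xi : 0 <= t ->
  expect_from P X eta t ((fun x => (x == xi)%:R) \o lift_config n) =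
  fine (P eta (X t @^-1` lift_event xi)).
Proof.
move=> t0; rewrite expect_lift // (bigD1 xi) //= eqxx mul1r big1 ?addr0 //.
by move=> x /negPf->; rewrite mul0r.
Qed.

Lemma measurable_transition t xi : 0 <= t -> measurable_fun setT
  ((fun zeta => fine (P zeta (X t @^-1` lift_event xi))) : config_meas -> R).
Proof.
move=> t0; apply: measurable_continuous.
under eq_fun do rewrite -expect_lift_ind //.
apply: (dfp_feller HX) => //; apply: local_continuous.
exact/local_funW/lift_local.
Qed.

Lemma transition_bound t zeta xi : 0 <= t -> `|fine (P zeta (X t @^-1` lift_event xi))| <= 1.
Proof.
move=> t0; have mA := measurable_X_event t0 (measurable_lift_event xi).
rewrite ger0_norm ?fine_ge0 // -lee_fin fineK ?fin_num_measure //.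
exact: probability_le1.
Qed.

(** [G \o lift_config n] is a finite combination of indicators of fibres, so the Markov property for
    events extends to it by linearity. *)
Lemma expect_markov eta t h G : 0 <= t -> 0 <= h ->
  expect_from P X eta (t + h) (G \o lift_config n) =
  expect_from P X eta t (fun zeta => expect_from P X zeta h (G \o lift_config n)).
Proof.
move=> t0 h0; rewrite expect_lift ?addr_ge0 //.
have -> : expect_from P X eta t (fun zeta => expect_from P X zeta h (G \o lift_config n)) =
    (\int[P eta]_w (\sum_xi G xi * fine (P (X t w) (X h @^-1` lift_event xi))))%R.
  by congr Rintegral; apply: funext => w; rewrite expect_lift.
rewrite (@Rintegral_bounded_sum _ _ _ _ _ _ _ (fun xi => `|G xi|)).
- apply: eq_bigr => xi _.
  rewrite RintegralZl //; last first.
    apply: (@probability_bounded_integrable _ _ _ _ _ 1).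
      exact: measurableT_comp (measurable_transition xi h0) (dfp_measurable HX t0).
    by move=> w; exact: transition_bound.
  congr (_ * fine _).
  (* The whole space lies in the history as the complement of the empty set. *)
  have hT : history X t setT by move=> B [[B0 BC _] _]; have := BC _ B0; rewrite setD0.
  have := dfp_markov HX eta t0 h0 hT (measurable_lift_event xi).
  rewrite setTI => ->; apply: eq_integral => w _.
  by rewrite fineK // fin_num_measure //; apply: measurable_X_event => //; exact: measurable_lift_event.
- move=> xi; apply: measurable_funM => //.
  exact: measurableT_comp (measurable_transition xi h0) (dfp_measurable HX t0).
- by move=> xi w; rewrite normrM ler_piMr //; exact: transition_bound.
Qed.

Lemma measurable_expect_lift h G : 0 <= h ->
  measurable_fun setT ((fun zeta => expect_from P X zeta h (G \o lift_config n)) : config_meas -> R).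
Proof.
move=> h0; apply: measurable_continuous; apply: (dfp_feller HX) => //.
exact/local_continuous/local_funW/lift_local.
Qed.

(** Expectation contracts the sup norm, so an error made in the last time step is not amplified by
    the time before it. *)
Lemma expect_step eta t h G G' (delta : R) : 0 <= t -> 0 <= h ->
  (forall zeta, `|expect_from P X zeta h (G \o lift_config n) - G' (lift_config n zeta)| <= delta) ->
  `|expect_from P X eta (t + h) (G \o lift_config n) -
    expect_from P X eta t (G' \o lift_config n)| <= delta.
Proof.
move=> t0 h0 close; rewrite expect_markov //.
pose q zeta := expect_from P X zeta h (G \o lift_config n).
have mq : measurable_fun setT (fun w => q (X t w)).
  exact: measurableT_comp (measurable_expect_lift G h0) (dfp_measurable HX t0).
have mG' : measurable_fun setT (fun w => G' (lift_config n (X t w))).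
  have := measurable_local (local_funW G' lift_local).
  by move=> m; exact: measurableT_comp m (dfp_measurable HX t0).
have G'b zeta : `|G' (lift_config n zeta)| <= \sum_xi `|G' xi|.
  by rewrite (bigD1 (lift_config n zeta)) //= lerDl sumr_ge0.
have qb zeta : `|q zeta| <= delta + \sum_xi `|G' xi|.
  rewrite -(subrK (G' (lift_config n zeta)) (q zeta)).
  by apply: (le_trans (ler_normD _ _)); apply: lerD; [exact: close|exact: G'b].
have iq := probability_bounded_integrable (P eta) mq (fun w => qb (X t w)).
have iG := probability_bounded_integrable (P eta) mG' (fun w => G'b (X t w)).
rewrite /expect_from -RintegralB //.
have mD : measurable_fun setT (fun w => q (X t w) - G' (lift_config n (X t w))).
  exact: measurable_funB.
by apply: normr_Rintegral_le => // w; exact: close.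
Qed.

End Process.

(** * The generator on box functions and the error of the Euler scheme *)

Section Generator.
Set Implicit Arguments.
Unset Strict Implicit.
Context {R : realType} (lambda : R) (lambda_gt0 : 0 < lambda) (n : nat).
Notation s := (Num.sqrt (1 + lambda)).
Notation N := (box_size n).
Implicit Types (eta zeta : config) (G : spins N -> R) (i : 'I_N).

Lemma sqrt_gt1 : 1 < s.
Proof. by rewrite -[X in X < _]sqrtr1 ltr_sqrt; have := lambda_gt0; lra. Qed.

Lemma sqr_sqrt1 : s ^+ 2 = 1 + lambda.
Proof. by rewrite sqr_sqrtr //; have := lambda_gt0; lra. Qed.

(** Since [lambda = (s - 1) * (s + 1)], the exchange rate has the same product form as the other
    two. *)
Lemma edge_rateE (a b : bool) : edge_rate lambda a b = (s - sgb a) * (s - sgb b) / 2.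
Proof.
have e := sqr_sqrt1; have l : lambda = s * s - 1 by rewrite -expr2 e; ring.
rewrite /edge_rate; set x := Num.sqrt _ in l *.
by case: a; case: b; rewrite /sgb /= ?expr2 ?opprK ?l //; field.
Qed.

Lemma edge_rate_bound (a b : bool) : 0 <= edge_rate lambda a b <= rate_max s.
Proof.
have s1 := sqrt_gt1; rewrite edge_rateE /rate_max.
have aux c : 0 <= s - sgb c <= s + 1 by case: c; rewrite /sgb; apply/andP; split; lra.
have /andP[p q] := aux a; have /andP[p' q'] := aux b.
rewrite divr_ge0 ?mulr_ge0 //= ler_pM2r ?invr_gt0 // expr2.
exact: ler_pM.
Qed.

Definition edge_pos i : int := vertex n i - 1.

Lemma generator_lift G zeta :
  dfp_generator lambda (G \o lift_config n) zeta =
  \sum_(i < N) edge_rate lambda (zeta (edge_pos i)) (zeta (edge_pos i + 1)) *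
    (G (lift_config n (double_flip zeta (edge_pos i))) - G (lift_config n zeta)).
Proof.
have inj : injective edge_pos.
  by move=> i j; rewrite /edge_pos /vertex => ij; apply: val_inj => /=; lia.
rewrite /dfp_generator (fsbigE [seq edge_pos i | i <- index_enum 'I_N]) //.
- by rewrite big_map; apply: eq_bigl => i; rewrite in_setT.
- by rewrite map_inj_uniq // index_enum_uniq.
move=> x _ xo /=; rewrite lift_double_flip_out ?subrr ?mulr0 //.
move=> i; apply: contraNneq xo => ->; apply/mapP; exists i => //.
exact: mem_index_enum.
Qed.

(** The product of two adjacent edge spins is the sign of the vertex between them, which identifies
    the two factors of the rates. *)
Lemma edge_rate_interior zeta i : (0 < i)%N -> (i.+1 < N)%N ->
  edge_rate lambda (zeta (edge_pos i)) (zeta (edge_pos i + 1)) =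
  glauber_rate s (lift_config n zeta) i.
Proof.
move=> i0 iN; have [j ij] : exists j, i = j.+1 :> nat by exists i.-1; rewrite prednK.
have jN : (j < N)%N by rewrite -ltnS -ij ltnW // ltnS ltnW.
have sp (k : 'I_N) : spin (R := R) (lift_config n zeta) k.+1 = sgb (lift_spin n zeta k).
  by rewrite spin_ord ffunE.
have sp1 := sp (Ordinal jN); have sp2 := sp i; have sp3 := sp (Ordinal iN).
rewrite /glauber_rate sp3 sp2 /= edge_rateE /edge_pos /vertex subrK.
rewrite (_ : spin _ i = spin (lift_config n zeta) j.+1); last by rewrite ij.
rewrite sp1 /= ij /= /vertex (_ : j.+1%:Z - n%:Z - 1 = j%:Z - n%:Z); last by lia.
have aux (a b : bool) : sgb a * sgb (a == b) = sgb b :> R.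
  by case: a; case: b; rewrite /sgb /=; ring.
by rewrite !aux.
Qed.

Definition even_fun G := forall xi, G (flip_all xi) = G xi.

(** At the two extreme edges the true rate depends on a vertex outside the box:
    this is the only error. *)
Lemma generator_euler G (w : 'I_N -> R) zeta : even_fun G -> flip_lipschitz w G ->
  `| dfp_generator lambda (G \o lift_config n) zeta -
     \sum_i glauber_rate s (lift_config n zeta) i *
       (G (flip (lift_config n zeta) i) - G (lift_config n zeta)) | <=
  rate_max s * (w ord0 + w ord_max).
Proof.
move=> evG wG; rewrite generator_lift -sumrB.
set xi := lift_config n zeta.
have flipE i : G (lift_config n (double_flip zeta (edge_pos i))) = G (flip xi i).
  rewrite /edge_pos; have [->|i0] := eqVneq i ord0.
    by rewrite lift_double_flip0 evG.
  by rewrite lift_double_flip.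
have w0 i : 0 <= w i by apply: le_trans (wG i xi); exact: normr_ge0.
have rm := rate_max_ge0 s.
apply: (le_trans (ler_norm_sum _ _ _)).
apply: (@le_trans _ _ (\sum_(i < N) rate_max s * w i *
   ((i == ord0)%:R + (i == ord_max)%:R))).
  apply: ler_sum => i _; rewrite flipE -mulrBl normrM.
  have b : `|edge_rate lambda (zeta (edge_pos i)) (zeta (edge_pos i + 1)) - glauber_rate s xi i|
      * `|G (flip xi i) - G xi| <= rate_max s * w i * 1.
    rewrite mulr1; apply: ler_pM => //.
    have /andP[a1 a2] := edge_rate_bound (zeta (edge_pos i)) (zeta (edge_pos i + 1)).
    have b1 := glauber_rate_ge0 sqrt_gt1 xi i; have b2 := glauber_rate_max sqrt_gt1 xi i.
    by rewrite ler_norml; apply/andP; split; lra.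
  have c0 : 0 <= rate_max s * w i by rewrite mulr_ge0.
  have [i0|i0] := eqVneq i ord0.
    by apply: (le_trans b); rewrite ler_wpM2l // lerDl.
  have [i1|i1] := eqVneq i ord_max.
    by apply: (le_trans b); rewrite ler_wpM2l // lerDr.
  rewrite edge_rate_interior ?subrr ?normr0 ?mul0r ?addr0 ?mulr0 //.
    by rewrite lt0n.
  have iN := ltn_ord i; rewrite ltn_neqAle iN andbT.
  by apply: contraNneq i1 => e; apply/eqP/val_inj => /=; move: e; rewrite /box_size; lia.
under eq_bigr do rewrite mulrDr.
have pick j : \sum_(i < N) rate_max s * w i * (i == j)%:R = rate_max s * w j.
  rewrite (bigD1 j) //= eqxx mulr1 big1 ?addr0 // => i /negPf->.
  by rewrite mulr0.
by rewrite big_split /= !pick mulrDr.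
Qed.

Context d (Omega : measurableType d)
  (P : config -> probability Omega R) (X : R -> Omega -> config)
  (HX : is_dfp lambda P X).

Definition ind (xi x : spins N) : R := (x == xi)%:R.

(** The limit in [dfp_generatorP] is uniform in the state but not in the function, and the Euler
    iterates depend on [h]. Control on the finitely many indicators gives, by linearity, control
    uniform over bounded functions on the box. *)
Definition good_step (e h : R) := forall xi eta,
  `| (expect_from P X eta h (ind xi \o lift_config n) - (ind xi \o lift_config n) eta) / h -
     dfp_generator lambda (ind xi \o lift_config n) eta | <= e.

Lemma near_good_step (e : R) : 0 < e -> \forall h \near 0^'+, good_step e h.
Proof.
move=> e0; apply: filter_forall => xi.
apply: (dfp_generatorP HX) => //.
exact/local_funW/lift_local.
Qed.

Lemma sum_ind G xi : \sum_x G x * ind x xi = G xi.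
Proof.
rewrite (bigD1 xi) //= /ind eqxx mulr1 big1 ?addr0 // => x ne.
by rewrite eq_sym (negPf ne) mulr0.
Qed.

Lemma generator_ind G eta : dfp_generator lambda (G \o lift_config n) eta =
  \sum_xi G xi * dfp_generator lambda (ind xi \o lift_config n) eta.
Proof.
under [RHS]eq_bigr do rewrite generator_lift mulr_sumr.
rewrite generator_lift exchange_big /=; apply: eq_bigr => i _.
rewrite -(sum_ind G (lift_config n (double_flip eta (edge_pos i)))).
rewrite -(sum_ind G (lift_config n eta)) -sumrB mulr_sumr.
by apply: eq_bigr => xi _; ring.
Qed.

Lemma expect_ind G eta t : 0 <= t -> expect_from P X eta t (G \o lift_config n) =
  \sum_xi G xi * expect_from P X eta t (ind xi \o lift_config n).
Proof.
move=> t0; rewrite (expect_lift HX) //.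
by apply: eq_bigr => xi _; rewrite -(expect_lift_ind HX).
Qed.

Lemma one_step (e h B : R) (w : 'I_N -> R) G eta : 0 < h -> good_step e h ->
  even_fun G -> flip_lipschitz w G -> (forall xi, `|G xi| <= B) ->
  `|expect_from P X eta h (G \o lift_config n) - euler s h G (lift_config n eta)| <=
  h * (e * (B * #|{: spins N}|%:R) + rate_max s * (w ord0 + w ord_max)).
Proof.
move=> h0 he evG wG GB.
set L := dfp_generator lambda (G \o lift_config n) eta.
(* Insert the first-order expansion: the process departs from it by the error of [good_step], the
   Euler step by the boundary error. *)
rewrite -(subrK (G (lift_config n eta) + h * L) (expect_from _ _ _ _ _)) -addrA.
apply: (le_trans (ler_normD _ _)); rewrite mulrDr; apply: lerD.
  rewrite (expect_ind G eta (ltW h0)) -(sum_ind G (lift_config n eta)) /L generator_ind.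
  rewrite mulr_sumr -big_split -sumrB /=.
  apply: (le_trans (ler_norm_sum _ _ _)).
  have -> : h * (e * (B * #|{: spins N}|%:R)) = \sum_(x : spins N) h * (e * B).
    by rewrite sumr_const -mulr_natr; ring.
  apply: ler_sum => xi _.
  have := he xi eta; set E := expect_from _ _ _ _ _; set D := dfp_generator _ _ _ => b.
  have -> : G xi * E - (G xi * ind xi (lift_config n eta) + h * (G xi * D)) =
    h * (G xi * ((E - ind xi (lift_config n eta)) / h - D)).
    by field; rewrite lt0r_neq0.
  rewrite normrM gtr0_norm // ler_wpM2l ?(ltW h0) // normrM [X in X <= _]mulrC.
  by apply: ler_pM.
have -> : G (lift_config n eta) + h * L - euler s h G (lift_config n eta) =
  h * (L - \sum_i glauber_rate s (lift_config n eta) i *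
       (G (flip (lift_config n eta) i) - G (lift_config n eta))).
  by rewrite /euler; ring.
rewrite normrM gtr0_norm // ler_wpM2l ?(ltW h0) //.
exact: generator_euler.
Qed.

Lemma many_steps (e h B : R) (w : 'I_N -> R) G eta k : 0 < h -> 0 <= e -> good_step e h ->
  small_step s N h -> even_fun G ->
  (forall i j : 'I_N, (i.+1 = j)%N \/ (j.+1 = i)%N -> w j <= 2 * w i) ->
  flip_lipschitz w G -> (forall xi, `|G xi| <= B) ->
  `|expect_from P X eta (k.+1%:R * h) (G \o lift_config n) -
    iter k.+1 (euler s h) G (lift_config n eta)| <=
  k.+1%:R * (h * (e * (B * #|{: spins N}|%:R) +
    rate_max s * ((1 + 6 * rate_max s * h) ^+ k * (w ord0 + w ord_max)))).
Proof.
move=> h0 e0 he hs evG w2 wG GB; have s1 := sqrt_gt1.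
pose theta := 1 + 6 * rate_max s * h.
have theta1 : 1 <= theta.
  by rewrite lerDl mulr_ge0 ?(ltW h0) // mulr_ge0 // rate_max_ge0.
set delta := h * (_ + _).
pose g j := iter j (euler s h) G.
have step j zeta : (j <= k)%N ->
    `|expect_from P X zeta h (g j \o lift_config n) - g j.+1 (lift_config n zeta)| <= delta.
  move=> jk.
  have evg : even_fun (g j).
    move=> xi; rewrite -[LHS]/((g j \o @flip_all N) xi) -iter_euler_flip_all.
    by congr (iter j _ _ _); apply: funext => x; exact: evG.
  have wg := iter_euler_lipschitz s1 j hs w2 wG.
  have gB := iter_euler_bound s1 j hs GB.
  apply: (le_trans (one_step zeta h0 he evg wg gB)).
  rewrite /delta ler_wpM2l ?(ltW h0) // lerD2l ler_wpM2l ?rate_max_ge0 //.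
  rewrite -mulrDr ler_wpM2r ?ler_weXn2l // addr_ge0 //.
    by apply: le_trans (wG ord0 (lift_config n zeta)); exact: normr_ge0.
  by apply: le_trans (wG ord_max (lift_config n zeta)); exact: normr_ge0.
(* Telescoping: in each round the last time step of the process becomes one more Euler step on the
   function. With [i + j <= k], every error is below the common [delta]. *)
have: forall j (i : nat), (i + j <= k)%N ->
  `|expect_from P X eta (j.+1%:R * h) (g i \o lift_config n) - g (i + j.+1)%N (lift_config n eta)|
    <= j.+1%:R * delta.
  elim=> [|j IH] i ijk; first by rewrite !mul1r addn1; apply: step; lia.
  have -> : j.+2%:R * h = j.+1%:R * h + h by rewrite -[in LHS]addn1 natrD; ring.
  have -> : j.+2%:R * delta = delta + j.+1%:R * delta by rewrite -[in LHS]addn1 natrD; ring.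
  rewrite -(subrK (expect_from P X eta (j.+1%:R * h) (g i.+1 \o lift_config n))
      (expect_from _ _ _ (_ + _) _)) -addrA.
  apply: (le_trans (ler_normD _ _)); apply: lerD.
    apply: (expect_step HX); [by rewrite mulr_ge0 ?ltW|exact: ltW|].
    by move=> zeta; apply: step; lia.
  by rewrite (_ : (i + j.+2 = i.+1 + j.+1)%N); [apply: IH; lia|lia].
by move=> /(_ k 0%N (leqnn _)).
Qed.

End Generator.

(** * The Bernoulli measure and the Gibbs weight *)

Section Invariant.
Set Implicit Arguments.
Unset Strict Implicit.
Context {R : realType} (lambda : R) (lambda_gt0 : 0 < lambda) (n : nat).
Notation s := (Num.sqrt (1 + lambda)).
Notation N := (box_size n).
Implicit Types (eta zeta : config) (G : spins N -> R) (xi : spins N).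
Context (mu : probability config_meas R) (Hmu : is_bernoulli_product (p_hat lambda) mu).

(** The mass of [gibbs] on states with leftmost spin up: the end factors give [s ^ 2], and each
    vertex gives [s + 1] or [s - 1], that is [2 * s] times a Bernoulli weight. *)
Definition gibbs_norm : R := s ^+ 2 * (2 * s) ^+ (n + n).+1.

Lemma gibbs_norm_gt0 : 0 < gibbs_norm.
Proof.
have s0 : 0 < s by apply: lt_trans (sqrt_gt1 lambda_gt0).
by rewrite mulr_gt0 // exprn_gt0 // mulr_gt0.
Qed.

Lemma gibbs_unlift xi : gibbs s xi = gibbs_norm *
  \prod_(j < (n + n).+1) (if config_of_spins xi (vertex n j) then p_hat lambda else 1 - p_hat lambda).
Proof.
have s0 : 0 < s by apply: lt_trans (sqrt_gt1 lambda_gt0).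
rewrite /gibbs big_ord_recl big_ord_recr /=.
rewrite [in X in X * _](_ : spin xi 0 = 0) // mul0r addr0.
rewrite [spin xi (bump 0 (n + n).+1).+1]spin_out ?mulr0 ?addr0 //.
have -> : gibbs_norm * \prod_(j < (n + n).+1)
    (if config_of_spins xi (vertex n j) then p_hat lambda else 1 - p_hat lambda) =
    s ^+ 2 * \prod_(j < (n + n).+1) (2 * s *
    (if config_of_spins xi (vertex n j) then p_hat lambda else 1 - p_hat lambda)).
  by rewrite big_split /= prodr_const card_ord /gibbs_norm -mulrA.
rewrite expr2 -mulrA [X in _ * X = _]mulrC; congr (_ * (_ * _)).
apply: eq_bigr => j _; have jn := ltn_ord j.
have jN : (j < N)%N by rewrite /box_size; lia.
have jN' : (j.+1 < N)%N by rewrite /box_size; lia.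
rewrite unlift_vertex; [|by lia].
rewrite (spin_at_ord xi (Ordinal jN)) (spin_at_ord xi (Ordinal jN')).
rewrite /bump /= add1n (spin_ord xi (Ordinal jN)) (spin_ord xi (Ordinal jN')) /p_hat.
by case: (xi _); case: (xi _); rewrite /sgb /=; field; rewrite lt0r_neq0.
Qed.

Lemma bernoulli_lift_event xi : xi ord0 ->
  mu (lift_event xi) = (gibbs s xi / gibbs_norm)%:E.
Proof.
move=> x0; have Z0 := gibbs_norm_gt0.
pose D := [seq vertex n j | j <- iota 0 (n + n).+1].
have uD : uniq D.
  rewrite map_inj_uniq ?iota_uniq // => i j; rewrite /vertex; lia.
have := Hmu (config_of_spins xi) uD.
rewrite big_map -/(index_iota 0 (n + n).+1) big_mkord gibbs_unlift mulrC mulKf ?lt0r_neq0 //.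
move=> <-; congr (mu _); apply/seteqP; split=> eta.
  move=> /liftP[_ e] x /mapP[j]; rewrite mem_iota add0n ltnS => /andP[_ jn] ->.
  exact: e.
move=> e; apply/liftP; split=> // j jn; apply: e.
by apply/mapP; exists j; rewrite // mem_iota add0n ltnS jn.
Qed.

Lemma bernoulli_lift_event0 xi : ~~ xi ord0 -> mu (lift_event xi) = 0%E.
Proof.
move=> /negP x0; rewrite (_ : lift_event xi = set0) ?measure0 //.
by apply/seteqP; split=> // eta /liftP[].
Qed.

(** The lift only reaches states with leftmost spin up. By evenness the global flip gives the other
    half the same contribution, whence the [2]. *)
Lemma bernoulli_even G : even_fun G ->
  \sum_xi G xi * fine (mu (lift_event xi)) = dot s (fun=> 1) G / (2 * gibbs_norm).
Proof.
move=> evG; have Z0 := gibbs_norm_gt0.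
rewrite (bigID (fun xi => xi ord0)) /= [X in _ + X]big1 ?addr0; last first.
  by move=> xi x0; rewrite bernoulli_lift_event0 // mulr0.
have -> : dot s (fun=> 1) G = 2 * \sum_(xi : spins N | xi ord0) gibbs s xi * G xi.
  rewrite /dot (bigID (fun xi : spins N => xi ord0)) /= mulr_natl mulr2n; congr (_ + _).
    by apply: eq_bigr => xi _; rewrite mulr1.
  rewrite (reindex_inj (inv_inj (@flip_allK N))) /=.
  apply: eq_big => xi; first by rewrite ffunE negbK.
  by move=> _; rewrite gibbs_flip_all evG mulr1.
rewrite -mulf_div mulfV ?pnatr_eq0 // mul1r mulr_suml.
by apply: eq_bigr => xi x0; rewrite bernoulli_lift_event //= mulrCA mulrA.
Qed.

Lemma bernoulli_total : \sum_(xi : spins N) fine (mu (lift_event xi)) = 1.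
Proof.
have := Rintegral_lift (n := n) mu (fun=> 1) (@measurable_id _ config_meas setT).
under eq_bigr do rewrite mul1r.
by move=> <-; rewrite Rintegral_probability_cst.
Qed.

(** Euler steps preserve the Gibbs mean, so the difference is an average of oscillations of the
    iterate, which [osc_decay] bounds. *)
Lemma euler_to_bernoulli (h : R) k (D : {set 'I_N}) G (B : R) xi :
  small_step s N h -> even_fun G -> local_on D G -> (forall x, `|G x| <= B) ->
  `|iter k (euler s h) G xi - (\int[mu]_zeta G (lift_config n zeta))%R| <=
    4 * B * #|D|%:R * (1 - h * decay_rate s) ^+ k.
Proof.
move=> hs evG GD GB; have s1 := sqrt_gt1 lambda_gt0.
rewrite (Rintegral_lift mu G (@measurable_id _ config_meas setT)).
rewrite bernoulli_even // -(dot_iter_euler s1 h k) -bernoulli_even; last first.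
  move=> x; rewrite -[LHS]/((iter k (euler s h) G \o @flip_all N) x) -iter_euler_flip_all.
  by congr (iter k _ _ _); apply: funext => y; exact: evG.
set g := iter k _ G; set T := (X in _ <= X).
rewrite -[X in `|X - _|]mulr1 -bernoulli_total mulr_sumr -sumrB.
apply: (le_trans (ler_norm_sum _ _ _)).
rewrite -[T]mulr1 -bernoulli_total mulr_sumr; apply: ler_sum => x _.
have q0 : 0 <= fine (mu (lift_event x)) by rewrite fine_ge0.
rewrite -mulrBl normrM (ger0_norm q0) ler_wpM2r //.
exact: osc_decay.
Qed.

End Invariant.

(** * Local functions seen from the box, and convergence *)

Section Window.
Set Implicit Arguments.
Unset Strict Implicit.
Context {R : realType} (f : config -> R) (D : seq int) (L n : nat).
Notation N := (box_size n).

(** The distance [|i - n|], as a sum of two truncated differences of which one vanishes. *)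
Definition box_dist (i : 'I_N) : nat := (i - n + (n - i))%N.

(** It halves with each edge away from the centre; the factor [2 ^+ L.+1] keeps it at least [2 * B]
    on [core], whose edges are at distance at most [L.+1]. *)
Definition box_weight (B : R) (i : 'I_N) : R := 2 * B * 2 ^+ L.+1 / 2 ^+ box_dist i.

Lemma box_weight_near (B : R) (i j : 'I_N) : 0 <= B -> (i.+1 = j)%N \/ (j.+1 = i)%N ->
  box_weight B j <= 2 * box_weight B i.
Proof.
move=> B0 ij; rewrite /box_weight mulrCA ler_wpM2l ?mulr_ge0 ?exprn_ge0 //.
rewrite ler_pdivlMr ?exprn_gt0 // mulrC ler_pdivrMr ?exprn_gt0 //.
rewrite -exprS ler_eXn2l ?ltr1n // /box_dist.
by case: ij; lia.
Qed.

Lemma box_weight_boundary (B : R) : 0 <= B ->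
  box_weight B ord0 + box_weight B ord_max <= 2 * (2 * B * 2 ^+ L.+1) / 2 ^+ n.
Proof.
move=> B0; have C0 : 0 <= 2 * B * 2 ^+ L.+1 :> R by rewrite mulr_ge0 ?mulr_ge0 ?exprn_ge0.
rewrite -mulrA mulr_natl mulr2n; apply: lerD; rewrite /box_weight ler_wpM2l //;
  rewrite lef_pV2 ?qualifE /= ?exprn_gt0 // ler_eXn2l ?ltr1n // /box_dist /=; lia.
Qed.

Hypothesis fD : forall eta zeta : config, {in D, forall x, eta x = zeta x} -> f eta = f zeta.
Hypothesis DL : forall x, x \in D -> (absz x <= L)%N.
Hypothesis Ln : (L <= n)%N.

Definition box_fun (xi : spins N) : R := f (config_of_spins xi).

Lemma box_fun_lift zeta : box_fun (lift_config n zeta) = f zeta.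
Proof.
apply: fD => x /DL xL; apply: unlift_lift; apply/andP; split; lia.
Qed.

Lemma box_fun_even : even_fun box_fun.
Proof. by move=> xi; rewrite /box_fun unlift_flip_all. Qed.

(** The edges that touch a vertex of absolute value at most [L]; these vertices have one edge more
    on the right. *)
Definition core : {set 'I_N} := [set i : 'I_N | (n <= i + L)%N && (i <= n + L.+1)%N]%SET.

Lemma card_core : (#|core| <= (L + L).+2)%N.
Proof.
have sub : core \subset [set inord (n - L + k) | k : 'I_((L + L).+2)]%SET.
  apply/fintype.subsetP => i; rewrite inE => /andP[a b]; apply/imsetP.
  have kL : (i + L - n < (L + L).+2)%N by lia.
  exists (Ordinal kL) => //; apply: val_inj; rewrite /= inordK; last first.
    by have := ltn_ord i; lia.
  by lia.
apply: leq_trans (subset_leq_card sub) _.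
by apply: leq_trans (leq_imset_card _ _) _; rewrite card_ord.
Qed.

Lemma box_fun_local : local_on core box_fun.
Proof.
move=> xi zeta xz; apply: fD => x /DL xL.
have /vertexP[j jn xj] : - n%:Z <= x <= n%:Z by apply/andP; split; lia.
have spE k : (n <= k + L)%N && (k <= n + L.+1)%N -> spin_at xi k = spin_at zeta k.
  move=> kc; rewrite /spin_at; case: insubP => //= i _ ik; apply: xz.
  by rewrite inE ik.
rewrite xj !unlift_vertex //; move: xj xL; rewrite /vertex => -> xL.
by rewrite !spE //; apply/andP; split; lia.
Qed.

Lemma box_fun_lipschitz (B : R) : (forall eta, `|f eta| <= B) ->
  flip_lipschitz (box_weight B) box_fun.
Proof.
move=> fB i xi; have B0 : 0 <= B by apply: le_trans (fB (config_of_spins xi)); exact: normr_ge0.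
have w0 : 0 <= box_weight B i by rewrite divr_ge0 ?mulr_ge0 ?exprn_ge0.
have [ic|ic] := boolP (i \in core); last first.
  rewrite (box_fun_local (zeta := xi)) ?subrr ?normr0 // => j jc.
  by rewrite ffunE; case: eqP => // ji; rewrite -ji jc in ic.
apply: (@le_trans _ _ (2 * B)).
  by apply: (le_trans (ler_normB _ _)); rewrite mulr_natl mulr2n lerD // fB.
rewrite /box_weight -mulrA ler_peMr ?mulr_ge0 // ler_pdivlMr ?exprn_gt0 // mul1r.
rewrite ler_eXn2l ?ltr1n // /box_dist; move: ic; rewrite inE => /andP[a b]; lia.
Qed.

End Window.

Section Convergence.
Set Implicit Arguments.
Unset Strict Implicit.

Lemma local_fun_bounded (R : realType) (f : config -> R) (D : seq int) :
  (forall eta zeta, {in D, forall x, eta x = zeta x} -> f eta = f zeta) ->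
  exists2 L : nat, (forall x, x \in D -> (absz x <= L)%N) &
  exists2 B : R, 0 <= B & forall eta, `|f eta| <= B.
Proof.
move=> fD; pose L := (\sum_(x <- D) absz x)%N.
have DL x : x \in D -> (absz x <= L)%N.
  by move=> xD; rewrite /L (big_rem x) //= leq_addr.
exists L => //; exists (\sum_xi `|@box_fun R f L xi|); first exact: sumr_ge0.
move=> eta; rewrite -(box_fun_lift fD DL (leqnn L)).
by rewrite (bigD1 (lift_config L eta)) //= lerDl sumr_ge0.
Qed.

Lemma exists_small_power (R : realType) (A e : R) (L : nat) : 0 <= A -> 0 < e ->
  exists2 n, (L <= n)%N & A / 2 ^+ n <= e.
Proof.
move=> A0 e0; pose m := Num.bound (A / e); exists (maxn L m); first exact: leq_maxl.
rewrite ler_pdivrMr ?exprn_gt0 // mulrC -ler_pdivrMr //.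
have Am : A / e < m%:R by apply: archi_boundP; rewrite divr_ge0 // ltW.
apply: (le_trans (ltW Am)).
rewrite -natrX ler_nat (leq_trans (leq_maxr L m)) //.
exact/ltnW/ltn_expl.
Qed.

Lemma dfp_convergence (R : realType) (lambda : R) (f : config -> R) (D : seq int)
    (L : nat) (B : R) (d : measure_display) (Omega : measurableType d)
    (P : config -> probability Omega R) (X : R -> Omega -> config)
    (mu : probability config_meas R) (eta : config) (t : R) :
  0 < lambda ->
  (forall eta zeta, {in D, forall x, eta x = zeta x} -> f eta = f zeta) ->
  (forall x, x \in D -> (absz x <= L)%N) -> (forall eta, `|f eta| <= B) ->
  is_dfp lambda P X -> is_bernoulli_product (p_hat lambda) mu -> 0 < t ->
  `|expect_from P X eta t f - (\int[mu]_zeta f zeta)%R| <=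
    4 * B * (L + L).+2%:R * expR (- decay_rate (Num.sqrt (1 + lambda)) * t).
Proof.
move=> l0 fD DL fB HX Hmu t0; have s1 := sqrt_gt1 l0.
set s := Num.sqrt _ in s1 *; set m := decay_rate s.
have B0 : 0 <= B by apply: le_trans (fB eta); exact: normr_ge0.
apply/ler_addgt0Pr => e e0.
have rm := rate_max_ge0 s.
have A0 : 0 <= t * rate_max s * expR (6 * rate_max s * t) * (2 * (2 * B * 2 ^+ L.+1)).
  apply: mulr_ge0.
    by apply: mulr_ge0; [apply: mulr_ge0; first exact: ltW|exact: expR_ge0].
  by apply: mulr_ge0 => //; apply: mulr_ge0; [exact: mulr_ge0|exact: exprn_ge0].
(* The box comes first: it makes the boundary error over time [t] at most [e / 2], uniformly in the
   step [h]. *)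
have [n Ln An] := exists_small_power L A0 (divr_gt0 e0 (ltr0Sn R 1)).
pose C := B * #|{: spins (box_size n)}|%:R.
have C0 : 0 <= C by rewrite mulr_ge0.
(* The tolerance depends on the number of states of the box now fixed, and keeps the accumulated
   error of the difference quotients below [e / 2]. *)
pose e1 := e / 2 / (t * (C + 1)).
have C1 : 0 < C + 1 by lra.
have e10 : 0 < e1 by rewrite divr_gt0 ?divr_gt0 ?mulr_gt0.
have te1 : t * (e1 * C) <= e / 2.
  have -> : t * (e1 * C) = e / 2 * (C / (C + 1)) by rewrite /e1; field; rewrite !lt0r_neq0.
  by rewrite ler_piMr ?divr_ge0 ?ltW // ltr_pdivrMr // mul1r ltrDl.
have [delta /= delta0 good] := near_good_step n HX e10.
pose M := (box_size n)%:R * (s + 1) ^+ 2.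
have M0 : 0 < M by rewrite mulr_gt0 ?ltr0n // exprn_gt0; lra.
(* So many steps that [h = t / k.+1] is below [delta], as [good_step] needs, and satisfies
   [h * M <= 1], which is [small_step]. *)
pose k := Num.bound (t * (delta^-1 + M)).
have tk : t * (delta^-1 + M) < k.+1%:R.
  apply: (@lt_trans _ _ k%:R); last by rewrite ltr_nat.
  apply: archi_boundP; rewrite mulr_ge0 ?addr_ge0 ?invr_ge0 ?ltW //.
have k0 : 0 < k.+1%:R :> R by rewrite ltr0n.
pose h := t / k.+1%:R.
have h0 : 0 < h by rewrite divr_gt0.
have kh : k.+1%:R * h = t by rewrite /h mulrC divfK ?lt0r_neq0.
have hd : h < delta.
  rewrite /h ltr_pdivrMr // -ltr_pdivrMl // mulrC; apply: le_lt_trans tk.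
  by rewrite ler_wpM2l ?ltW // ltrDl.
have hM : h * M <= 1.
  rewrite /h mulrAC ler_pdivrMr // mul1r; apply: le_trans (ltW tk).
  by rewrite ler_wpM2l ?ltW // ltrDr invr_gt0.
have hs : small_step s (box_size n) h.
  by split; [exact: ltW|rewrite -mulrA].
have hgood : good_step lambda n P X e1 h.
  by apply: good => //=; rewrite sub0r normrN gtr0_norm.
pose F := @box_fun R f n.
have FB xi : `|F xi| <= B by exact: fB.
have fF : f = F \o lift_config n.
  by apply: funext => zeta; exact: esym (box_fun_lift fD DL Ln zeta).
have evF : even_fun F := @box_fun_even R f n.
have steps := many_steps l0 HX eta k h0 (ltW e10) hgood hs evF
  (fun i j => @box_weight_near R L n B i j B0) (box_fun_lipschitz fD DL Ln fB) FB.
have mixing := euler_to_bernoulli l0 Hmu k.+1 (lift_config n eta) hs evF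
  (box_fun_local fD DL Ln) FB.
(* Applied twice: with [a = - m] for the decay, and with [a = 6 * rate_max s] for the growth of the
   influence. *)
have expk (a : R) : 0 <= 1 + a * h -> (1 + a * h) ^+ k.+1 <= expR (a * t).
  move=> p; have -> : a * t = k.+1%:R * (a * h) by rewrite -{1}kh mulrCA.
  rewrite expRM_natl; apply: lerXn2r; rewrite ?qualifE /= ?expR_ge0 //.
  exact: expR_ge1Dx.
have IE : (\int[mu]_zeta F (lift_config n zeta))%R = (\int[mu]_zeta f zeta)%R.
  by rewrite [in RHS]fF.
rewrite IE in mixing; rewrite kh -fF in steps.
set E := expect_from _ _ _ _ _ in steps *; set I := Rintegral _ _ _ in mixing *.
set K := iter _ _ _ _ in steps mixing.
have -> : E - I = (K - I) + (E - K) by ring.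
apply: (le_trans (ler_normD _ _)); apply: lerD.
  apply: (le_trans mixing); rewrite -/s -/m.
  have [_ /= hm] := step_decay_ge0 s1 (isT : (0 < box_size n)%N) hs.
  have c : #|core L n|%:R <= (L + L).+2%:R :> R by rewrite ler_nat card_core.
  apply: ler_pM; [by rewrite !mulr_ge0|by rewrite exprn_ge0| |].
    by rewrite ler_wpM2l // mulr_ge0.
  have := expk (- m); rewrite mulNr [m * h]mulrC; apply.
  exact: hm.
apply: (le_trans steps); rewrite mulrA kh mulrDr [leRHS]splitr; apply: lerD; first exact: te1.
apply: le_trans An.
rewrite [leRHS](_ : _ = t * (rate_max s * (expR (6 * rate_max s * t) *
  (2 * (2 * B * 2 ^+ L.+1) / 2 ^+ n)))); last by rewrite !mulrA.
rewrite (ler_wpM2l (ltW t0)) // (ler_wpM2l rm) //.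
have w := box_weight_boundary L n B0.
have theta1 : 1 <= 1 + 6 * rate_max s * h.
  by rewrite lerDl; apply: mulr_ge0; [apply: mulr_ge0|exact: ltW].
have theta0 : 0 <= 1 + 6 * rate_max s * h by apply: le_trans theta1.
apply: ler_pM.
- by rewrite exprn_ge0.
- by rewrite addr_ge0 // /box_weight divr_ge0 ?exprn_ge0 // mulr_ge0 ?exprn_ge0 // mulr_ge0.
- by apply: le_trans (expk _ theta0); rewrite ler_weXn2l.
- exact: w.
Qed.

End Convergence.

Theorem theorem5p2 (R : realType) (lambda : R) (lambda_gt0 : 0 < lambda) :
  exists m : R, 0 < m /\
  forall f : config -> R, local_fun f ->
  exists C_f : R, 0 < C_f /\
  forall (d : measure_display) (Omega : measurableType d)
    (P : config -> probability Omega R) (X : R -> Omega -> config)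
    (pi_hat : probability config_meas R),
  is_dfp lambda P X ->
  is_bernoulli_product (p_hat lambda) pi_hat ->
  forall t : R, 0 <= t ->
  (ereal_sup [set `| expect_from P X eta t f
                     - (\int[pi_hat]_zeta f zeta)%R |%:E | eta in [set: config]]
   <= (C_f * expR (- m * t))%:E)%E.
Proof.
exists (decay_rate (Num.sqrt (1 + lambda))).
split; first exact/decay_rate_gt0/sqrt_gt1.
move=> f floc; have mf := measurable_local floc.
have [D fD] := floc; have [L DL [B B0 fB]] := local_fun_bounded fD.
have A0 : 0 <= 4 * B * (L + L).+2%:R by rewrite !mulr_ge0.
(* The term [2 * B] covers [t = 0], and the [1] makes the constant positive even if [B = 0]. *)
exists (4 * B * (L + L).+2%:R + 2 * B + 1); split; first lra.
move=> d Omega P X pi_hat HX Hpi t t_ge0; apply: ub_ereal_sup => _ [eta _ <-].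
rewrite lee_fin; move: t_ge0; rewrite le_eqVlt => /predU1P[<-|t0].
  rewrite mulr0 expR0 mulr1.
  have E0 : `|expect_from P X eta 0 f| <= B.
    apply: normr_Rintegral_le => [|w]; last exact: fB.
    exact: measurableT_comp mf (dfp_measurable HX (lexx 0)).
  have I0 : `|\int[pi_hat]_zeta f zeta|%R <= B by exact: normr_Rintegral_le.
  by apply: (le_trans (ler_normB _ _)); lra.
apply: (le_trans (dfp_convergence eta lambda_gt0 fD DL fB HX Hpi t0)).
by rewrite ler_wpM2r ?expR_ge0 //; lra.
Qed.
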